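(* Let $n$ be a positive integer and $r>0$. The class of $n$-dimensional Alexandrov spaces with nonnegative curvature does not satisfy any uniform $n$-dimensional $(C,\beta)$-tetrahedral property for radius $r$; that is, for every $C>0$ and $\beta\in(0,1)$ there is an $n$-dimensional Alexandrov space of curvature $\ge0$ that does not satisfy the $n$-dimensional $(C,\beta)$-tetrahedral property for radius $r$. The same remains true if the spaces in the class are required to have diameter bigger than $r$, or if they are required to be closed (complete and without boundary).
   Context: For a metric space $(X,d)$ with metric completion $\bar X$ (and $d$ extended to $\bar X$), $q\in\bar X$ and $t>0$, put $S(q;t)=\{x\in X: d(x,q)=t\}$. Given $p\in X$, $r>0$, $p_1,\dots,p_{n-1}\in\bar X$ and $t_1,\dots,t_{n-1}>0$, let $S=S(p;r)\cap S(p_1;t_1)\cap\dots\cap S(p_{n-1};t_{n-1})$, and let $h(p,r,t_1,\dots,t_{n-1})=\inf\{d(x,y):x\ne y,\ x,y\in S\}$ if $|S|\ge2$ and $0$ otherwise. For $C>0$, $\beta\in(0,1)$, $(X,d)$ has the $n$-dimensional $(C,\beta)$-tetrahedral property at $p$ for radius $r$ if there exist $p_1,\dots,p_{n-1}\in\bar X$ with $d(p,p_i)=r$ such that $h(p,r,t_1,\dots,t_{n-1})\ge Cr$ for all $(t_1,\dots,t_{n-1})\in[(1-\beta)r,(1+\beta)r]^{n-1}$. It satisfies the property for radius $r$ if it has it at every point $p\in X$ for radius $r$. *)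

(* Defs.v *)
From HB Require Import structures.
From mathcomp Require Import all_boot all_order all_algebra.
From mathcomp Require Import all_classical all_reals all_analysis.

Set Implicit Arguments.
Unset Strict Implicit.
Unset Printing Implicit Defensive.
Import Order.TTheory GRing.Theory Num.Theory.
Import numFieldNormedType.Exports.
Local Open Scope classical_set_scope.
Local Open Scope ring_scope.

Section MetricSpaces.
Context {R : realType}.
Implicit Types X Y : metricType R.

Definition complete_space X : Prop :=
  forall u : nat -> X, cauchy (u @ \oo) -> exists x : X, u @ \oo --> x.

Definition is_completion X Y (i : X -> Y) : Prop :=
  [/\ forall x y, mdist (i x) (i y) = mdist x y,
      dense (range i) & complete_space Y].

(* The element 0 is added only so that the empty set has diameter 0. *)
Definition diam X (A : set X) : \bar R :=
  ereal_sup (0%E |` [set (mdist xy.1 xy.2)%:E | xy in A `*` A]).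

(* As in total_variation, a partition of [a, b] is given by its points other
   than a. *)
Definition path_length X (g : R -> X) (a b : R) : \bar R :=
  ereal_sup [set (\sum_(0 <= k < size s)
                    mdist (g (nth b (a :: s) k)) (g (nth b (a :: s) k.+1)))%:E
            | s in itv_partition a b].

(* The infimum is +oo when no path joins x to y. *)
Definition length_space X : Prop := forall x y : X,
  (mdist x y)%:E =
  ereal_inf [set path_length g 0 1
            | g in [set g : R -> X |
                     [/\ {within `[0, 1], continuous g}, g 0 = x & g 1 = y]]].

(* Exponents s are positive throughout, so 0 `^ 0 = 1 never matters; the
   normalising constant of Hausdorff measure is omitted. *)
Definition hausdorff_premeasure X (s delta : R) : \bar R :=
  ereal_inf [set (\sum_(0 <= k <oo) diam (U k) `^ s)%E
            | U in [set U : nat -> set X |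
                     \bigcup_k U k = [set: X] /\
                     forall k, (diam (U k) <= delta%:E)%E]].

Definition hausdorff_measure X (s : R) : \bar R :=
  ereal_sup [set hausdorff_premeasure X s delta
            | delta in [set delta : R | 0 < delta]].

Definition hausdorff_dim X : \bar R :=
  ereal_inf [set s%:E | s in [set s : R | 0 < s /\ hausdorff_measure X s = 0%E]].

(* The angle at p of the Euclidean triangle with the same side lengths as
   (p, a, b); meaningful when a and b differ from p. *)
Definition comparison_angle X (p a b : X) : R :=
  acos ((mdist p a ^+ 2 + mdist p b ^+ 2 - mdist a b ^+ 2)
        / (2 * mdist p a * mdist p b)).

(* The quadruple condition of Burago, Gromov and Perelman. *)
Definition curvature_ge0 X : Prop := forall x : X, exists2 U : set X, nbhs x U &
  forall p a b c : X, U p -> U a -> U b -> U c ->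
    uniq [:: p; a; b; c] ->
    comparison_angle p a b + comparison_angle p b c + comparison_angle p c a
      <= 2 * pi.

Definition alexandrov_ge0 (n : nat) X : Prop :=
  [/\ complete_space X, length_space X, curvature_ge0 X
    & hausdorff_dim X = n%:R%:E].

(* Shortest paths issuing from p, parametrised by arc length on
   [0, geo_len]; the values of geo_fun elsewhere are irrelevant. *)
Record geodesic X (p : X) := Geodesic {
  geo_fun :> R -> X ;
  geo_len : R ;
  geo_len_gt0 : 0 < geo_len ;
  geo_start : geo_fun 0 = p ;
  geo_dist : forall s t, 0 <= s <= geo_len -> 0 <= t <= geo_len ->
    mdist (geo_fun s) (geo_fun t) = `|s - t| }.

Definition angle X (p : X) (g h : geodesic p) : R :=
  lim (comparison_angle p (g st.1) (h st.2)
        @[st --> filter_prod (0 : R)^'+ (0 : R)^'+]).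

(* The space of directions at p is the completion of the set of geodesics from
   p, modulo angle 0, metrised by the angle. It is characterised here up to
   isometry: two geodesics have the same image under dir exactly when they make
   angle 0. *)
Definition is_space_of_directions X (p : X) Y (dir : geodesic p -> Y) : Prop :=
  [/\ forall g h, mdist (dir g) (dir h) = angle g h,
      dense (range dir) & complete_space Y].

(* The boundary of an n-dimensional Alexandrov space, by induction on n: p is a
   boundary point when its space of directions, of dimension n - 1, has nonempty
   boundary. In dimension 0, a single point is its own boundary and a pair of
   points has none, so that in dimension 1 the boundary points are those with
   exactly one direction, i.e. the endpoints of the 1-manifold. *)
Fixpoint alexandrov_boundary (n : nat) X : set X :=
  match n with
  | 0 => [set x | [set: X] = [set x]]
  | m.+1 => [set p | exists (Y : metricType R) (dir : geodesic p -> Y),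
               is_space_of_directions dir /\ @alexandrov_boundary m Y !=set0]
  end.

Definition closed_alexandrov (n : nat) X : Prop :=
  complete_space X /\ @alexandrov_boundary n X = set0.

Section Tetrahedral.
Variables (X Y : metricType R) (i : X -> Y).

Definition metric_sphere (q : Y) (t : R) : set X :=
  [set x | mdist (i x) q = t].

Definition tetra_set (m : nat) (p : X) (r : R) (q : 'I_m -> Y) (t : 'I_m -> R) :
    set X :=
  metric_sphere (i p) r `&` \bigcap_j metric_sphere (q j) (t j).

Definition tetra_h (m : nat) (p : X) (r : R) (q : 'I_m -> Y) (t : 'I_m -> R) :
    R :=
  let S := tetra_set p r q t in
  if `[< exists x y, [/\ S x, S y & x <> y] >] then
    inf [set mdist xy.1 xy.2 | xy in [set xy | [/\ xy.1 <> xy.2, S xy.1 & S xy.2]]]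
  else 0.

(* The property involves n - 1 auxiliary points besides p. *)
Definition tetrahedral_at (n : nat) (C beta r : R) (p : X) : Prop :=
  exists q : 'I_n.-1 -> Y,
    (forall j, mdist (i p) (q j) = r) /\
    (forall t : 'I_n.-1 -> R,
       (forall j, (1 - beta) * r <= t j <= (1 + beta) * r) ->
       C * r <= tetra_h p r q t).

End Tetrahedral.

(* The completion of X being unique up to isometry, it does not matter which one
   is used. *)
Definition tetrahedral (n : nat) (C beta r : R) X : Prop :=
  forall (Y : metricType R) (i : X -> Y), is_completion i ->
  forall p : X, tetrahedral_at i n C beta r p.

End MetricSpaces.

(* Main.v *)
Require Import Defs.
From HB Require Import structures.
From mathcomp Require Import all_boot all_order all_algebra.
From mathcomp Require Import all_classical all_reals all_analysis.
From mathcomp Require Import zify ring lra.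
Import Order.TTheory GRing.Theory Num.Theory.
Import numFieldNormedType.Exports.
Local Open Scope classical_set_scope.
Local Open Scope ring_scope.

(* A single space does everything: a flat torus with one circle of length 2r + e
   and n - 1 circles of length e, where e is small compared with C r. A point at
   distance r from p lies within O(n e) of the point antipodal to p on the long
   circle, so two such points are never at distance C r; yet the diameter exceeds
   r. Locally the torus is isometric to R^n. The quadruple condition then follows
   from the spherical triangle inequality applied to u, -v, w; its spaces of
   directions are round spheres, and so, inductively, are the spaces of directions
   of those, down to pairs of antipodal points, so there is no boundary. The upper
   bound on the Hausdorff dimension comes from grid covers. For the lower bound a
   cover is made finite by compactness, and each piece of diameter D contains at
   most (D N / rho + 1)^n points of a grid of N^n points with mesh rho / N. *)

Set Implicit Arguments.
Unset Strict Implicit.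
Unset Printing Implicit Defensive.

(** * Euclidean geometry *)

Section Euclidean.
Context {R : realType} {n : nat}.
Implicit Types (u v w x : 'rV[R]_n) (a b : R).

Definition dot u v : R := \sum_i u 0 i * v 0 i.
Definition enorm u : R := Num.sqrt (dot u u).

Lemma dotC u v : dot u v = dot v u.
Proof. by apply: eq_bigr => i _; rewrite mulrC. Qed.

Lemma dotDl u v w : dot (u + v) w = dot u w + dot v w.
Proof. by rewrite -big_split; apply: eq_bigr => i _; rewrite mxE mulrDl. Qed.

Lemma dotZl a u v : dot (a *: u) v = a * dot u v.
Proof. by rewrite /dot mulr_sumr; apply: eq_bigr => i _; rewrite mxE mulrA. Qed.

Lemma dotNl u v : dot (- u) v = - dot u v.
Proof. by rewrite -scaleN1r dotZl mulN1r. Qed.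

Lemma dotDr u v w : dot w (u + v) = dot w u + dot w v.
Proof. by rewrite dotC dotDl !(dotC w). Qed.

Lemma dotZr a u v : dot v (a *: u) = a * dot v u.
Proof. by rewrite dotC dotZl (dotC v). Qed.

Lemma dotNr u v : dot v (- u) = - dot v u.
Proof. by rewrite dotC dotNl (dotC v). Qed.

Definition dotE := (dotDl, dotDr, dotZl, dotZr, dotNl, dotNr).

Lemma dot_ge0 u : 0 <= dot u u.
Proof. by apply: sumr_ge0 => i _; rewrite -expr2 sqr_ge0. Qed.

Lemma dot_eq0 u : dot u u = 0 -> u = 0.
Proof.
move/eqP; rewrite psumr_eq0 => [|i _]; last by rewrite -expr2 sqr_ge0.
move/allP => h; apply/rowP => i; rewrite mxE; apply/eqP.
by have := h i; rewrite mem_index_enum mulf_eq0 orbb; apply.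
Qed.

Lemma enorm_ge0 u : 0 <= enorm u. Proof. exact: sqrtr_ge0. Qed.

Lemma sqr_enorm u : enorm u ^+ 2 = dot u u.
Proof. by rewrite sqr_sqrtr// dot_ge0. Qed.

Lemma enorm_gt0 u : u != 0 -> 0 < enorm u.
Proof.
move=> u0; rewrite sqrtr_gt0 lt_def dot_ge0 andbT.
by apply: contra u0 => /eqP/dot_eq0->.
Qed.

Lemma enorm_eq0 u : enorm u = 0 -> u = 0.
Proof. by move=> u0; apply: dot_eq0; rewrite -sqr_enorm u0 expr0n. Qed.

Lemma enorm0 : enorm 0 = 0.
Proof. by rewrite /enorm -(scale0r 0) dotZl mul0r sqrtr0. Qed.

Lemma enormZ a u : enorm (a *: u) = `|a| * enorm u.
Proof.
by rewrite /enorm dotZl dotZr mulrA -expr2 sqrtrM ?sqr_ge0// sqrtr_sqr.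
Qed.

Lemma enormN u : enorm (- u) = enorm u.
Proof. by rewrite -scaleN1r enormZ normrN normr1 mul1r. Qed.

Lemma enormB u v : enorm (u - v) = enorm (v - u).
Proof. by rewrite -enormN opprB. Qed.

Lemma cauchy_schwarz_sqr u v : dot u v ^+ 2 <= dot u u * dot v v.
Proof.
have [->|v0] := eqVneq v 0.
  by rewrite -(scale0r 0) dotZr dotZl !mul0r expr0n mulr0.
have vv : 0 < dot v v by rewrite -sqr_enorm exprn_gt0// enorm_gt0.
rewrite -subr_ge0 -(pmulr_rge0 _ vv).
(* This squared norm equals [dot v v * (dot u u * dot v v - dot u v ^+ 2)]. *)
have := dot_ge0 (dot v v *: u - dot u v *: v).
by rewrite !dotE (dotC v u); congr (0 <= _); ring.
Qed.

Lemma cauchy_schwarz u v : `|dot u v| <= enorm u * enorm v.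
Proof.
rewrite -(@ler_pXn2r _ 2)// ?nnegrE ?mulr_ge0 ?enorm_ge0//.
by rewrite exprMn !sqr_enorm real_normK ?num_real// cauchy_schwarz_sqr.
Qed.

Lemma ler_enormD u v : enorm (u + v) <= enorm u + enorm v.
Proof.
rewrite -(@ler_pXn2r _ 2)// ?nnegrE ?addr_ge0 ?enorm_ge0//.
rewrite sqrrD !sqr_enorm !dotE (dotC v u).
have := le_trans (ler_norm _) (cauchy_schwarz u v); lra.
Qed.

Lemma ler_enorm u v : (forall i, `|u 0 i| <= `|v 0 i|) -> enorm u <= enorm v.
Proof.
move=> uv; rewrite ler_wsqrtr// ler_sum// => i _.
rewrite -!expr2 -(real_normK (num_real (u 0 i))) -(real_normK (num_real (v 0 i))).
by rewrite ler_pXn2r ?nnegrE.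
Qed.

Lemma coord_le_enorm u i : `|u 0 i| <= enorm u.
Proof.
rewrite -(@ler_pXn2r _ 2)// ?nnegrE ?enorm_ge0// sqr_enorm /dot (bigD1 i)//=.
rewrite real_normK ?num_real// -expr2 lerDl sumr_ge0// => j _.
by rewrite -expr2 sqr_ge0.
Qed.

Lemma enorm_delta i : enorm (delta_mx 0 i) = 1.
Proof.
rewrite /enorm /dot (bigD1 i)//= big1 => [|j ji]; rewrite !mxE !eqxx.
  by rewrite addr0 mul1r sqrtr1.
by rewrite (negbTE ji) mul0r.
Qed.

Lemma enorm_le_sum u : enorm u <= \sum_i `|u 0 i|.
Proof.
rewrite [in leLHS](row_sum_delta u); elim/big_ind2 : _ => [|a x b y ax by_|i _].
- by rewrite enorm0.
- exact: le_trans (ler_enormD _ _) (lerD _ _).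
- by rewrite enormZ enorm_delta mulr1.
Qed.

Lemma unit_dot_bound u v : dot u u = 1 -> dot v v = 1 -> -1 <= dot u v <= 1.
Proof.
move=> u1 v1; rewrite -ler_norml (le_trans (cauchy_schwarz u v))//.
by rewrite /enorm u1 v1 sqrtr1 mulr1.
Qed.

Lemma unit_dot1 u v : dot u u = 1 -> dot v v = 1 -> dot u v = 1 -> u = v.
Proof.
move=> u1 v1 uv; apply/eqP; rewrite -subr_eq0; apply/eqP/dot_eq0.
by rewrite !dotE (dotC v u) u1 v1 uv; lra.
Qed.

Definition normalize u := (enorm u)^-1 *: u.

Lemma dot_normalize u : u != 0 -> dot (normalize u) (normalize u) = 1.
Proof.
move=> /enorm_gt0 u0; rewrite dotZl dotZr -sqr_enorm.
by field; rewrite gt_eqF.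
Qed.

(* Gram-Schmidt: the components of [u] and [w] orthogonal to [x] have norms
   [sin (acos (dot u x))] and [sin (acos (dot x w))]. *)
Lemma acos_dot_triangle u x w :
  dot u u = 1 -> dot x x = 1 -> dot w w = 1 ->
  acos (dot u w) <= acos (dot u x) + acos (dot x w).
Proof.
move=> u1 x1 w1.
have ux := unit_dot_bound u1 x1; have xw := unit_dot_bound x1 w1.
have uw := unit_dot_bound u1 w1.
have [|lepi] := leP pi (acos (dot u x) + acos (dot x w)).
  by apply: le_trans; exact: acos_lepi.
rewrite leNgt; apply/negP => lt_uw.
have ia : acos (dot u x) + acos (dot x w) \in `[0, pi].
  by rewrite in_itv/= (ltW lepi) addr_ge0 ?acos_ge0.
have ib : acos (dot u w) \in `[0, pi].
  by rewrite in_itv/= acos_ge0 ?acos_lepi.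
have := ltr_cos ia ib; rewrite lt_uw cosD !acosK ?in_itv//= !sin_acos//.
apply/negP; rewrite -leNgt lerBlDr -lerBlDl.
set c := dot u x; set d := dot x w.
have := cauchy_schwarz (u - c *: x) (w - d *: x).
rewrite ler_norml => /andP[+ _].
rewrite /enorm !dotE u1 x1 w1 (dotC x u) (dotC w x) -/c -/d.
have -> : 1 + - (c * c) + (- (c * c) + - (c * - (c * 1))) = 1 - c ^+ 2 by ring.
have -> : 1 + - (d * d) + (- (d * d) + - (d * - (d * 1))) = 1 - d ^+ 2 by ring.
lra.
Qed.

(** The triangle inequality through the antipode [- v] reads [acos (dot w u) <= (pi - acos (dot w
    v)) + (pi - acos (dot v u))]. *)
Lemma acos_dot_perimeter u v w :
  dot u u = 1 -> dot v v = 1 -> dot w w = 1 ->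
  acos (dot u v) + acos (dot v w) + acos (dot w u) <= 2 * pi.
Proof.
move=> u1 v1 w1.
have Nv1 : dot (- v) (- v) = 1 by rewrite dotNl dotNr opprK.
have := acos_dot_triangle w1 Nv1 u1.
rewrite dotNr dotNl !acosN ?unit_dot_bound// (dotC w v) (dotC v u); lra.
Qed.

(** Law of cosines in the Euclidean triangle with vertices 0, [u], [v]. *)
Lemma acos_flat_angle u v : u != 0 -> v != 0 ->
  (enorm u ^+ 2 + enorm v ^+ 2 - enorm (u - v) ^+ 2) / (2 * enorm u * enorm v)
  = dot (normalize u) (normalize v).
Proof.
move=> u0 v0; rewrite !sqr_enorm dotZl dotZr !dotE (dotC v u).
by field; rewrite !gt_eqF// enorm_gt0.
Qed.

Lemma flat_perimeter (p a b c : 'rV[R]_n) : uniq [:: p; a; b; c] ->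
  let ang (a b : 'rV[R]_n) :=
    acos ((enorm (p - a) ^+ 2 + enorm (p - b) ^+ 2 - enorm (a - b) ^+ 2)
      / (2 * enorm (p - a) * enorm (p - b))) in
  ang a b + ang b c + ang c a <= 2 * pi.
Proof.
rewrite /= !inE !negb_or => /andP[/and3P[pa pb pc] _].
have h y z : p != y -> p != z ->
    (enorm (p - y) ^+ 2 + enorm (p - z) ^+ 2 - enorm (y - z) ^+ 2)
        / (2 * enorm (p - y) * enorm (p - z))
    = dot (normalize (p - y)) (normalize (p - z)).
  move=> py pz; rewrite -acos_flat_angle ?subr_eq0//.
  rewrite (enormB y) (_ : p - y - (p - z) = z - y)//.
  by apply/rowP => i; rewrite !mxE; ring.
by rewrite !h// acos_dot_perimeter// dot_normalize ?subr_eq0.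
Qed.

End Euclidean.

(** * Spherical trigonometry *)

Section Trigonometry.
Context {R : realType}.
Implicit Types (x y s t c e : R).

(** The inverse of the continuous map [cos] on the segment from 0 to [pi] is continuous on the image
    segment. *)
Lemma acos_within_continuous : {within `[-1, 1], continuous (@acos R)}.
Proof.
rewrite -cospi -cos0; apply: segment_can_ge_continuous; first exact: pi_ge0.
  by apply: continuous_subspaceT => x; exact: continuous_cos.
exact: cosK.
Qed.

(** Continuity of [acos] is known only within [-1, 1], so [f] must eventually stay there; this
    matters when [c] is an endpoint, as for angle 0. *)
Lemma cvg_acos {T} (F : set_system T) {FF : Filter F} (f : T -> R) c :
  -1 <= c <= 1 -> (\forall z \near F, -1 <= f z <= 1) ->
  f @ F --> c -> acos (f z) @[z --> F] --> acos c.
Proof.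
move=> cI fI fc.
have cW : [set` `[(-1 : R), 1]] c by rewrite /= in_itv.
apply: cvg_trans ((subspace_continuousP _ _).1 acos_within_continuous c cW).
move=> A /= [e e0 eA].
suff : \forall z \near F, A (acos (f z)) by [].
near=> z; apply: (eA (f z)); last by rewrite /= in_itv/=; near: z.
rewrite /=; near: z; exact: cvgr_dist_lt fc _ e0.
Unshelve. all: by end_near. Qed.

Lemma sin_quotient_bound e : 0 < e ->
  exists2 d, 0 < d & forall x, 0 < x < d -> `|sin x / x - 1| < e.
Proof.
move=> e0.
(* The quotient is the difference quotient of [sin] at 0, whose limit is [cos 0 = 1]. *)
have : (fun h => h^-1 *: (sin (h *: 1 + 0) - sin 0)) @ (0 : R)^' --> (cos 0 : R).
  by rewrite -(@derive_val _ _ _ _ _ _ _ (is_derive_sin 0)); exact: derivable_sin.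
move=> /cvgrPdist_lt/(_ _ e0)[d d0 dP]; exists d => // x /andP[x0 xd].
have /= := dP x; rewrite cos0 sin0 subr0 addr0 [`|0 - x|]distrC.
rewrite /GRing.scale/= mulr1 [x^-1 * _]mulrC => h.
by rewrite distrC h ?gt_eqF// subr0 gtr0_norm.
Qed.

Lemma cosB_prod x y : cos x - cos y = 2 * sin ((x + y) / 2) * sin ((y - x) / 2).
Proof.
set u := (x + y) / 2; set v := (y - x) / 2.
have -> : cos x = cos (u - v) by congr cos; rewrite /u /v; field.
have -> : cos y = cos (u + v) by congr cos; rewrite /u /v; field.
by rewrite cosB cosD; ring.
Qed.

(** Spherical law of cosines: the third side of a triangle on the unit sphere with sides [s], [t]
    enclosing an angle of cosine [c]. *)
Definition spherical_side c s t := acos (cos s * cos t + c * (sin s * sin t)).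

(* Writing cos s cos t + c sin s sin t as a convex combination of cos (s - t)
   and cos (s + t). *)
Lemma spherical_side_bound c s t : -1 <= c <= 1 -> 0 <= s -> 0 <= t -> s + t <= pi ->
  [/\ -1 <= cos s * cos t + c * (sin s * sin t) <= 1,
      `|s - t| <= spherical_side c s t & spherical_side c s t <= s + t].
Proof.
move=> /andP[c1 c2] s0 t0 stpi.
have sst : 0 <= sin s * sin t by rewrite mulr_ge0// sin_ge0_pi//; apply/andP; split; lra.
have cD : cos (s + t) <= cos s * cos t + c * (sin s * sin t) by rewrite cosD; nra.
have cB : cos s * cos t + c * (sin s * sin t) <= cos `|s - t|.
  by rewrite cos_norm cosB; nra.
have I : -1 <= cos s * cos t + c * (sin s * sin t) <= 1.
  by rewrite (le_trans (cos_geN1 _) cD) (le_trans cB (cos_le1 _)).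
have aI : acos (cos s * cos t + c * (sin s * sin t)) \in `[0, pi].
  by rewrite in_itv/= acos_ge0 ?acos_lepi.
split => //; rewrite leNgt; apply/negP => lt1.
- have : cos `|s - t| < cos (spherical_side c s t).
    rewrite ltr_cos// in_itv/= normr_ge0/= ler_norml; apply/andP; split; lra.
  by rewrite acosK ?in_itv//= ltNge cB.
- have : cos (spherical_side c s t) < cos (s + t).
    rewrite ltr_cos// in_itv/= ; apply/andP; split; lra.
  by rewrite acosK ?in_itv//= ltNge cD.
Qed.

(** Small spherical triangles are almost Euclidean. With [x] the third side and [m = |s - t|], the
    law of cosines becomes [(1 - c) sin s sin t = 2 sin ((m + x) / 2) sin ((x - m) / 2)]; replacing
    each sine by its argument would give the Euclidean law exactly. *)
Lemma spherical_comparison_bound e : 0 < e ->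
  exists2 d, 0 < d & forall c s t, -1 <= c <= 1 -> 0 < s < d -> 0 < t < d ->
    `|(s ^+ 2 + t ^+ 2 - spherical_side c s t ^+ 2) / (2 * s * t) - c| < e.
Proof.
(* The error times [B] will be at most [12 * h], and [h <= 1/4] gives [B >= 1/4]; so the error is at
   most [48 * h < e]. *)
move=> e0; pose h := Num.min (4^-1) (e / 49).
have h0 : 0 < h by rewrite lt_min invr_gt0 ltr0n/= divr_gt0.
have h1 : h <= 4^-1 by rewrite ge_min lexx.
have h2 : 49 * h <= e by rewrite mulrC -ler_pdivlMr// ge_min lexx orbT.
have [d0 d00 d0P] := sin_quotient_bound h0.
have p0 := @pi_gt0 R.
(* Since [m <= x <= s + t], all four arguments of [sin] stay below [d0], and [s + t <= pi]. *)
exists (Num.min (d0 / 2) (pi / 2)); first by rewrite lt_min !divr_gt0.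
move=> c s t cI /andP[s0]; rewrite lt_min => /andP[sd spi] /andP[t0].
rewrite lt_min => /andP[td tpi].
have stpi : s + t <= pi by lra.
have [I b1 b2] := spherical_side_bound cI (ltW s0) (ltW t0) stpi.
move: b1 b2; set m := `|s - t|; set x := spherical_side c s t => b1 b2.
have m2 : m ^+ 2 = (s - t) ^+ 2 by rewrite real_normK// num_real.
have cx : cos x = cos s * cos t + c * (sin s * sin t) by rewrite acosK ?in_itv.
have m0 : 0 <= m by exact: normr_ge0.
have key : (1 - c) * (sin s * sin t) = 2 * sin ((m + x) / 2) * sin ((x - m) / 2).
  by rewrite -cosB_prod cx cos_norm cosB; ring.
(* The factor form also covers [u = 0], which occurs when [x = m]. *)
have sE u : 0 <= u -> u < d0 -> exists2 k, sin u = u * k & 1 - h <= k <= 1 + h.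
  rewrite le_eqVlt => /predU1P[<- _|u0 ud].
    by exists 1; rewrite ?sin0 ?mul0r//; apply/andP; split; lra.
  exists (sin u / u); first by field; rewrite gt_eqF.
  have := d0P u; rewrite u0 ud ltr_norml => /(_ isT)/andP[? ?].
  by apply/andP; split; lra.
have [k1 e1 /andP[k1l k1u]] : exists2 k, sin s = s * k &
    1 - h <= k <= 1 + h by apply: sE; lra.
have [k2 e2 /andP[k2l k2u]] : exists2 k, sin t = t * k &
    1 - h <= k <= 1 + h by apply: sE; lra.
have [k3 e3 /andP[k3l k3u]] : exists2 k, sin ((m + x) / 2) = (m + x) / 2 * k &
    1 - h <= k <= 1 + h.
  by apply: sE; lra.
have [k4 e4 /andP[k4l k4u]] : exists2 k, sin ((x - m) / 2) = (x - m) / 2 * k &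
    1 - h <= k <= 1 + h.
  by apply: sE; lra.
pose A := k1 * k2; pose B := k3 * k4.
have A1 : 1 - 3 * h <= A by rewrite /A; nra.
have A2 : A <= 1 + 3 * h by rewrite /A; nra.
have B1 : 1 - 3 * h <= B by rewrite /B; nra.
have B2 : B <= 1 + 3 * h by rewrite /B; nra.
set X := (x ^+ 2 - m ^+ 2) / (2 * s * t).
have XE : X * B = (1 - c) * A.
  have : (1 - c) * (s * t * A) = (x ^+ 2 - m ^+ 2) / 2 * B.
    transitivity ((1 - c) * (sin s * sin t)); first by rewrite e1 e2 /A; ring.
    by rewrite key e3 e4 /B; field.
  move=> q; rewrite /X; apply: (@mulfI _ (s * t)); first by rewrite mulf_neq0// gt_eqF.
  rewrite [RHS](_ : _ = (1 - c) * (s * t * A)); last by ring.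
  by rewrite q; field; rewrite !gt_eqF.
have -> : (s ^+ 2 + t ^+ 2 - x ^+ 2) / (2 * s * t) - c = (1 - c) - X.
  by rewrite /X m2; field; rewrite !gt_eqF.
have B4 : 4^-1 <= B by lra.
have e1' : `|(1 - c) - X| * B = `|(1 - c) * (B - A)|.
  rewrite -[in LHS](@ger0_norm _ B) -?normrM; last by lra.
  by rewrite mulrBl XE -mulrBr.
have h3 : `|(1 - c) * (B - A)| <= 12 * h.
  by case/andP: cI => c1 c2; rewrite ler_norml; apply/andP; split; nra.
have := normr_ge0 (1 - c - X); nra.
Qed.

End Trigonometry.

(** * Angles and spaces of directions *)

Section Angles.
Context {R : realType} {X : metricType R}.

Lemma comparison_cos_bound (p a b : X) :
  -1 <= (mdist p a ^+ 2 + mdist p b ^+ 2 - mdist a b ^+ 2)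
        / (2 * mdist p a * mdist p b) <= 1.
Proof.
(* In the degenerate cases the denominator is 0 and the quotient is 0 by convention; otherwise the
   bounds are the triangle inequalities. *)
have [pa0|pa0] := eqVneq (mdist p a) 0.
  by rewrite pa0 mulr0 mul0r invr0 mulr0 lerN10 ler01.
have [pb0|pb0] := eqVneq (mdist p b) 0.
  by rewrite pb0 mulr0 invr0 mulr0 lerN10 ler01.
have {}pa0 : 0 < mdist p a by rewrite lt_def pa0 mdist_ge0.
have {}pb0 : 0 < mdist p b by rewrite lt_def pb0 mdist_ge0.
have := metric_triangle p a b; have := metric_triangle p b a.
have := metric_triangle a p b; rewrite (metric_sym a p) (metric_sym b a).
have := mdist_ge0 a b => *.
rewrite ler_pdivlMr ?ler_pdivrMr ?mulr_gt0//; apply/andP; split; nra.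
Qed.

Lemma near_right_pair (e : R) : 0 < e ->
  \forall st \near filter_prod (0 : R)^'+ (0 : R)^'+, 0 < st.1 < e /\ 0 < st.2 < e.
Proof.
move=> e0; exists ([set s | 0 < s < e], [set s | 0 < s < e]) => //=.
by split; near=> s; apply/andP; split; near: s;
  [exact: nbhs_right_gt|exact: nbhs_right_lt|exact: nbhs_right_gt|exact: nbhs_right_lt].
Unshelve. all: by end_near. Qed.

Lemma geo_dist0 (p : X) (g : geodesic p) s : 0 <= s <= geo_len g -> mdist p (g s) = s.
Proof.
move=> sI; have g0 : 0 <= (0 : R) <= geo_len g by rewrite lexx (ltW (geo_len_gt0 g)).
have := geo_dist g0 sI; rewrite geo_start => ->.
by rewrite sub0r normrN ger0_norm//; case/andP: sI.
Qed.

(* The sides at [p] of the comparison triangle of [g s] and [h t] are [s] and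
   [t], so the angle is determined by [mdist (g s) (h t)] for small [s], [t]. *)
Lemma angle_cvg (p : X) (g h : geodesic p) (c : R) : -1 <= c <= 1 ->
  (forall e, 0 < e -> exists2 d, 0 < d & forall s t, 0 < s < d -> 0 < t < d ->
     `|(s ^+ 2 + t ^+ 2 - mdist (g s) (h t) ^+ 2) / (2 * s * t) - c| < e) ->
  angle g h = acos c.
Proof.
move=> cI gh; apply: cvg_lim; first exact: Rhausdorff.
apply: cvg_acos => //; first by near=> st; exact: comparison_cos_bound.
apply/cvgrPdist_lt => e /gh[d d0 dP].
have m0 : 0 < Num.min d (Num.min (geo_len g) (geo_len h)).
  by rewrite !lt_min d0 !geo_len_gt0.
apply: filterS (near_right_pair m0) => -[s t] /= [/andP[s0]].
rewrite !lt_min => /and3P[sd sg sh] /andP[t0 /and3P[td tg th]].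
rewrite !geo_dist0 ?(ltW s0) ?(ltW t0) ?(ltW sg) ?(ltW th)//.
by rewrite distrC dP// ?s0 ?t0.
Unshelve. all: by end_near. Qed.

End Angles.

Section Spheres.
Context {R : realType} {n : nat}.
Implicit Types (es : seq 'rV[R]_n) (u v : 'rV[R]_n).

Lemma continuous_dot u : continuous (fun v => dot u v).
Proof.
apply: (@continuous_big R^o _ _ _ xpredT (@add_continuous R^o)).
move=> i _ v; exact: (@cvgM R _ _ _ _ _ (u 0 i) (v 0 i) (cvg_cst _)
  (@coord_continuous _ _ _ _ _ v)).
Qed.

Lemma continuous_dotxx : continuous (fun v => dot v v).
Proof.
apply: (@continuous_big R^o _ _ _ xpredT (@add_continuous R^o)).
move=> i _ v; exact: (@cvgM R _ _ _ _ _ (v 0 i) (v 0 i)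
  (@coord_continuous _ _ _ _ _ v) (@coord_continuous _ _ _ _ _ v)).
Qed.

(** The unit sphere of the orthogonal complement of [es]. Passing to directions adds a vector to
    [es], so all the iterated spheres live in one ambient space, without a choice of bases. *)
Definition unit_orth es : set 'rV[R]_n :=
  [set u | dot u u = 1 /\ forall e, e \in es -> dot e u = 0].

Lemma unit_orth_compact es : compact (unit_orth es).
Proof.
apply: (@subclosed_compact _ _
  [set v : 'rV[R]_n | forall i, `[-1, 1]%classic (v ord0 i)]).
- have -> : unit_orth es = (fun v => dot v v) @^-1` [set 1] `&`
      \bigcap_(e in [set e | e \in es]) dot e @^-1` [set 0] by [].
  apply: closedI; first by apply: preimage_closed => // x _; exact: continuous_dotxx.
  apply: closed_bigI => e _; apply: preimage_closed => // x _; exact: continuous_dot.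
- exact: (@rV_compact R n (fun=> `[-1, 1]%classic) (fun=> @segment_compact _ _ _)).
- move=> u [u1 _] i; rewrite /= in_itv/= -ler_norml (le_trans (coord_le_enorm _ _))//.
  by rewrite /enorm u1 sqrtr1.
Qed.

(** [Y] is a round sphere with its angular metric. *)
Definition sphere_embedding es (Y : metricType R) (f : Y -> 'rV[R]_n) : Prop :=
  range f = unit_orth es /\ forall x y, mdist x y = acos (dot (f x) (f y)).

(** The directions of geodesics already fill a compact sphere, so completion adds nothing:
    [range dir] is compact, hence closed, and it is dense, so it is all of [Y]. *)
Lemma space_of_directions_sphere es (X Y : metricType R) (p : X)
    (dir : geodesic p -> Y) (v : geodesic p -> 'rV[R]_n) :
  range v = unit_orth es -> (forall g h, angle g h = acos (dot (v g) (v h))) ->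
  is_space_of_directions dir -> exists f : Y -> 'rV[R]_n, sphere_embedding es f.
Proof.
move=> rv av [dd dense_dir _].
have v1 g : unit_orth es (v g) by rewrite -rv; exists g.
have dirE g h : mdist (dir g) (dir h) = acos (dot (v g) (v h)) by rewrite dd av.
have dir_surj y : exists g, dir g = y.
  have [_ [_ [g0 _ _]]] : exists z, setT z /\ range dir z.
    by apply: (dense_dir setT _ openT); exists y.
  (* [phi] sends [v g] to [dir g]; off the sphere it takes the arbitrary value [dir g0]. *)
  have /choice[phi phiP] : forall u, exists z, unit_orth es u ->
      exists2 g, v g = u & dir g = z.
    move=> u; have [uS|nuS] := pselect (unit_orth es u); last by exists (dir g0).
    by have : range v u by [rewrite rv]; move=> [g _ <-]; exists (dir g) => _; exists g.
  have phi_dist u w : unit_orth es u -> unit_orth es w ->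
      mdist (phi u) (phi w) = acos (dot u w).
    by move=> /phiP[g <- <-] /phiP[h <- <-].
  have cphi : {within unit_orth es, continuous phi}.
    apply/subspace_continuousP => u uS.
    apply/metricType_numDomainType.cvgrPdist_lt => e e0.
    have nS : \forall w \near within (unit_orth es) (nbhs u), unit_orth es w.
      by exact: withinT.
    have : acos (dot u w) @[w --> within (unit_orth es) (nbhs u)] --> acos (1 : R).
      apply: cvg_acos; first by apply/andP; split; lra.
        by apply: filterS nS => w [w1 _]; exact: unit_dot_bound uS.1 w1.
      by rewrite -uS.1; apply: cvg_within_filter; exact: continuous_dot.
    rewrite acos1 => /cvgrPdist_lt/(_ _ e0) h.
    apply: filterS2 nS h => w wS; rewrite sub0r normrN phi_dist//.
    exact: le_lt_trans (ler_norm _).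
  have : closed (phi @` unit_orth es).
    apply: compact_closed; first exact: metric_hausdorff.
    by apply: (continuous_compact cphi); exact: unit_orth_compact.
  have -> : phi @` unit_orth es = range dir.
    apply/seteqP; split => [_ [u /phiP[g _ <-] <-]|_ [g _ <-]]; first by exists g.
    exists (v g) => //; apply: mdist_positivity.
    have [h hv <-] := phiP _ (v1 g).
    by rewrite dirE hv (v1 g).1 acos1.
  move=> /closure_id cl.
  have : closure (range dir) y.
    move=> B /nbhs_interior nB.
    have [|z [Bz rz]] := dense_dir (B^°) _ (@open_interior _ _).
      by exists y; exact: nbhs_singleton.
    by exists z; split=> //; exact: interior_subset.
  by rewrite -cl => -[g _ gy]; exists g.
have /choice[k kP] := dir_surj.
exists (v \o k); split; last by move=> x y; rewrite -dirE !kP.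
rewrite -rv; apply/seteqP; split => [_ [y _ <-]|_ [g _ <-]]; first by exists (k y).
exists (dir g) => //=; apply: unit_dot1; [exact: (v1 _).1|exact: (v1 _).1|].
have := dirE (k (dir g)) g; rewrite kP mdistxx => /(congr1 (@cos R)).
by rewrite cos0 acosK// in_itv/= unit_dot_bound//; [exact: (v1 _).1|exact: (v1 _).1].
Qed.

End Spheres.

(** * Round spheres *)

Section SphereGeodesics.
Context {R : realType} {n : nat} (es : seq 'rV[R]_n) (Y : metricType R).
Variables (f : Y -> 'rV[R]_n) (fS : sphere_embedding es f).

Let f1 y : unit_orth es (f y). Proof. by rewrite -fS.1; exists y. Qed.

Let dot_f x y : dot (f x) (f y) = cos (mdist x y).
Proof. by rewrite fS.2 acosK// in_itv/= unit_dot_bound//; exact: (f1 _).1. Qed.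

Let f_inj x y : f x = f y -> x = y.
Proof.
by move=> xy; apply: mdist_positivity; rewrite fS.2 xy (f1 y).1 acos1.
Qed.

Variable p : Y.
Implicit Types g h : geodesic p.

(** The initial velocity, obtained by solving the great circle equation
    [f (g s) = cos s *: f p + sin s *: v] for [v]. *)
Definition sphere_dir_at g s := (sin s)^-1 *: (f (g s) - cos s *: f p).

(** The cap 1, being less than [pi], keeps [sin] positive. *)
Definition sphere_scale g := Num.min (geo_len g) 1.

Definition sphere_dir g := sphere_dir_at g (sphere_scale g).

Let scale_gt0 g : 0 < sphere_scale g.
Proof. by rewrite lt_min geo_len_gt0 ltr01. Qed.

Let sin_scale g s : 0 < s <= sphere_scale g -> 0 < sin s.
Proof.
move=> /andP[s0]; rewrite le_min => /andP[_ s1]; apply: sin_gt0_pi.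
by rewrite s0/=; have := @pi_ge2 R; lra.
Qed.

(** Distances along [g] are [|s - t|], so the product is [(cos (s - t) - cos s cos t) / (sin s sin
    t) = 1]. For unit vectors this is the equality case of Cauchy-Schwarz, so the direction does not
    depend on [s]. *)
Let dot_dir_at g s t : 0 < s <= sphere_scale g -> 0 < t <= sphere_scale g ->
  dot (sphere_dir_at g s) (sphere_dir_at g t) = 1.
Proof.
move=> sI tI; have := sin_scale sI; have := sin_scale tI.
case/andP: sI => s0; case/andP: tI => t0; rewrite !le_min => /andP[tl _] /andP[sl _] ss st.
rewrite !dotE !dot_f mdistxx (metric_sym _ p) !geo_dist0 ?geo_dist ?(ltW s0) ?(ltW t0)//.
by rewrite cos_norm cosB cos0; field; rewrite !gt_eqF.
Qed.

Let unit_orth_dir_at g s : 0 < s <= sphere_scale g ->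
  unit_orth (f p :: es) (sphere_dir_at g s).
Proof.
move=> sI; split; first exact: dot_dir_at.
have := sin_scale sI; case/andP: sI => s0; rewrite le_min => /andP[sl _] ss.
move=> e; rewrite inE => /predU1P[->|ees].
  by rewrite !dotE !dot_f mdistxx geo_dist0 ?(ltW s0)// cos0; ring.
by rewrite !dotE !(f1 _).2//; ring.
Qed.

Let sphere_dirE g s : 0 < s <= sphere_scale g -> sphere_dir_at g s = sphere_dir g.
Proof.
have sc : 0 < sphere_scale g <= sphere_scale g by rewrite scale_gt0 lexx.
by move=> sI; apply: unit_dot1; exact: dot_dir_at.
Qed.

Let great_circle g s : 0 < s <= sphere_scale g ->
  f (g s) = cos s *: f p + sin s *: sphere_dir g.
Proof.
move=> sI; rewrite -(sphere_dirE sI) scalerA divff ?gt_eqF ?(sin_scale sI)//.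
by rewrite scale1r addrC subrK.
Qed.

Lemma range_sphere_dir : range sphere_dir = unit_orth (f p :: es).
Proof.
apply/seteqP; split => [_ [g _ <-]|u [u1 uo]].
  by apply: unit_orth_dir_at; rewrite scale_gt0 lexx.
have pu : dot (f p) u = 0 by rewrite uo// mem_head.
have up : dot u (f p) = 0 by rewrite dotC.
(* Conversely, the great circle through [f p] with velocity [u] stays in the sphere and lifts
   through [f] to a geodesic of [Y] with direction [u]. *)
have cuP s : unit_orth es (cos s *: f p + sin s *: u).
  split=> [|e ees]; last by rewrite !dotE (f1 p).2// uo ?inE ?ees ?orbT//; ring.
  by rewrite !dotE (f1 p).1 u1 pu up -[RHS](cos2Dsin2 s); ring.
have /choice[g gP] s : exists y, f y = cos s *: f p + sin s *: u.
  by have := cuP s; rewrite -fS.1 => -[y _ <-]; exists y.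
have g0 : g 0 = p by apply: f_inj; rewrite gP cos0 sin0 scale0r addr0 scale1r.
have gd s t : 0 <= s <= 1 -> 0 <= t <= 1 -> mdist (g s) (g t) = `|s - t|.
  move=> /andP[s0 s1] /andP[t0 t1]; rewrite fS.2 !gP.
  rewrite [dot _ _](_ : _ = cos `|s - t|).
    rewrite cosK// in_itv/= normr_ge0 ler_norml/=; have := @pi_ge2 R => ?.
    by apply/andP; split; lra.
  by rewrite cos_norm cosB !dotE (f1 p).1 u1 pu up; ring.
pose gg := Geodesic ltr01 g0 gd; exists gg => //.
have -> : sphere_dir gg = (sin 1)^-1 *: (f (g 1) - cos 1 *: f p).
  by rewrite /sphere_dir /sphere_dir_at /sphere_scale/= minxx.
rewrite gP addrC addKr scalerA mulVf ?scale1r// gt_eqF// sin_gt0_pi// ltr01/=.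
by have := @pi_ge2 R; lra.
Qed.

Lemma angle_sphere_dir g h : angle g h = acos (dot (sphere_dir g) (sphere_dir h)).
Proof.
have u1 k : dot (sphere_dir k) (sphere_dir k) = 1.
  by apply: dot_dir_at; rewrite scale_gt0 lexx.
have k0 k : dot (f p) (sphere_dir k) = 0.
  have [|_] := @unit_orth_dir_at k (sphere_scale k); first by rewrite scale_gt0 lexx.
  by apply; exact: mem_head.
have cI := unit_dot_bound (u1 g) (u1 h); apply: angle_cvg => // e.
move=> /spherical_comparison_bound[d d0 dP].
exists (Num.min d (Num.min (sphere_scale g) (sphere_scale h))).
  by rewrite lt_min d0 lt_min !scale_gt0.
move=> s t /andP[s0 +] /andP[t0 +].
rewrite lt_min => /andP[sd]; rewrite lt_min => /andP[sg _].
rewrite lt_min => /andP[td]; rewrite lt_min => /andP[_ th].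
rewrite fS.2 [dot (f _) (f _)](_ : _ = cos s * cos t +
  dot (sphere_dir g) (sphere_dir h) * (sin s * sin t)).
  by apply: dP; rewrite ?s0 ?t0.
rewrite !great_circle ?s0 ?t0 ?(ltW sg) ?(ltW th)//.
move: (k0 g) (k0 h); move: (sphere_dir g) (sphere_dir h) => v w pv pw.
by rewrite !dotE (f1 p).1 pw (dotC v) pv; ring.
Qed.

End SphereGeodesics.

(* Each space of directions of a round sphere is again a round sphere, and in
   dimension 0 a nonempty sphere contains two antipodal points. *)
Lemma sphere_boundary (R : realType) n m (es : seq 'rV[R]_n) (Y : metricType R)
    (f : Y -> 'rV[R]_n) :
  sphere_embedding es f -> @alexandrov_boundary R m Y = set0.
Proof.
elim: m es Y f => [|m IH] es Y f fS; apply/seteqP; split => // p /=.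
  move=> Yp; have [p1 po] : unit_orth es (f p) by rewrite -fS.1; exists p.
  have [q _ fq] : range f (- f p).
    rewrite fS.1; split; first by rewrite dotNl dotNr opprK.
    by move=> e ees; rewrite dotNr po ?oppr0.
  have : [set: Y] q by []. rewrite Yp => /= qp.
  have : dot (f p) (- f p) = 1 by rewrite -fq qp.
  by rewrite dotNr p1; lra.
move=> [Y' [dir [dirP]]].
have [f' f'S] := space_of_directions_sphere
  (range_sphere_dir fS p) (@angle_sphere_dir _ _ _ _ _ fS p) dirP.
by rewrite (IH _ _ _ f'S) => -[].
Qed.

(** * Distance to a lattice on the line *)

Section LatticeDistance.
Context {R : realType} (l : {posnum R}).
Implicit Types (a b : R) (k : int).

(** Adding one half before [floor] rounds to the nearest integer. *)
Definition lattice_dist a : R :=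
  `|a - l%:num * (Num.floor (a / l%:num + 2^-1))%:~R|.

Lemma lattice_dist_ge0 a : 0 <= lattice_dist a. Proof. exact: normr_ge0. Qed.

Lemma lattice_dist_le_half a : lattice_dist a <= l%:num / 2.
Proof.
have l0 : 0 < l%:num by [].
have /andP[] := floor_itv (a / l%:num + 2^-1).
rewrite intrD; set k := _%:~R => h1 h2.
have e : a / l%:num * l%:num = a by rewrite divfK ?gt_eqF.
rewrite ler_norml; apply/andP; split; nra.
Qed.

(** Any other multiple is at least [l] away from the chosen one, which is within [l / 2] of [a]. *)
Lemma lattice_dist_min a k : lattice_dist a <= `|a - l%:num * k%:~R|.
Proof.
rewrite /lattice_dist; set k0 := Num.floor _.
have [->//|kk0] := eqVneq k k0.
have : 1 <= `|k0%:~R - k%:~R : R|.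
  by rewrite -intrB -intr_norm -[1]/(1%:~R) ler_int -gtz0_ge1 normr_gt0 subr_eq0 eq_sym.
have := lattice_dist_le_half a; rewrite /lattice_dist -/k0.
have l0 : 0 < l%:num by [].
have := ler_distD a (l%:num * k0%:~R) (l%:num * k%:~R).
rewrite -mulrBr normrM gtr0_norm// (distrC _ a).
move=> h1 h2 h3; have : l%:num <= l%:num * `|k0%:~R - k%:~R| by rewrite ler_pMr.
lra.
Qed.

Lemma lattice_distP a : exists2 k, lattice_dist a = `|a - l%:num * k%:~R| &
  `|a - l%:num * k%:~R| <= l%:num / 2.
Proof. by exists (Num.floor (a / l%:num + 2^-1)) => //; exact: lattice_dist_le_half. Qed.

Lemma lattice_dist_period a k : lattice_dist (a + l%:num * k%:~R) = lattice_dist a.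
Proof.
apply/eqP; rewrite eq_le; apply/andP; split.
- have [j -> _] := lattice_distP a; rewrite (le_trans (lattice_dist_min _ (j + k)))//.
  by rewrite intrD le_eqVlt; apply/orP; left; apply/eqP; congr `|_|; ring.
- have [j -> _] := lattice_distP (a + l%:num * k%:~R).
  rewrite (le_trans (lattice_dist_min _ (j - k)))//.
  by rewrite intrB le_eqVlt; apply/orP; left; apply/eqP; congr `|_|; ring.
Qed.

Lemma lattice_distN a : lattice_dist (- a) = lattice_dist a.
Proof.
have h b : lattice_dist (- b) <= lattice_dist b.
  have [j -> _] := lattice_distP b; rewrite (le_trans (lattice_dist_min _ (- j)))//.
  by rewrite intrN mulrN opprK addrC distrC.
by apply/eqP; rewrite eq_le h -{1}(opprK a) h.
Qed.

Lemma lattice_distD a b : lattice_dist (a + b) <= lattice_dist a + lattice_dist b.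
Proof.
have [i -> _] := lattice_distP a; have [j -> _] := lattice_distP b.
rewrite (le_trans (lattice_dist_min _ (i + j)))// (le_trans _ (ler_normD _ _))//.
by rewrite intrD le_eqVlt; apply/orP; left; apply/eqP; congr `|_|; ring.
Qed.

Lemma lattice_dist_le_norm a : lattice_dist a <= `|a|.
Proof. by rewrite (le_trans (lattice_dist_min _ 0))// mulr0 subr0. Qed.

Lemma lattice_dist_small a : `|a| <= l%:num / 2 -> lattice_dist a = `|a|.
Proof.
move=> al; apply/eqP; rewrite eq_le lattice_dist_le_norm/=.
have [k -> _] := lattice_distP a.
have [->|k0] := eqVneq k 0; first by rewrite mulr0 subr0.
have : 1 <= `|k%:~R : R|.
  by rewrite -intr_norm -[1]/(1%:~R) ler_int -gtz0_ge1 normr_gt0.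
have l0 : 0 < l%:num by [].
move=> k1; have : l%:num <= l%:num * `|k%:~R| by rewrite ler_pMr.
rewrite -{2}(gtr0_norm l0) -normrM => h.
have := ler_normB (l%:num * k%:~R) a; rewrite (distrC _ a).
by have := lerB_dist (l%:num * k%:~R) a; rewrite (distrC _ a); lra.
Qed.

(** A triangle on a circle of length [l] has perimeter at most [l]. Let [u], [v] be the residues of
    [a], [b] in [-l/2, l/2]. With equal signs the sum is at most [2 max (|u|, |v|)]; with opposite
    signs, going round the other way bounds the first term by [l - |u - v|]. *)
Lemma lattice_dist_perimeter a b :
  lattice_dist (a - b) + lattice_dist a + lattice_dist b <= l%:num.
Proof.
have [i -> ai] := lattice_distP a; have [j -> bj] := lattice_distP b.
have := lattice_dist_min (a - b) (i - j); have := lattice_dist_min (a - b) (i - j - 1).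
have := lattice_dist_min (a - b) (i - j + 1).
rewrite !(intrD, intrN) mulr1z !(mulrDr, mulrN) mulr1.
move: (lattice_dist _) ai bj => D; set x := l%:num * i%:~R; set y := l%:num * j%:~R.
rewrite (_ : a - b - (x + - y + l%:num) = (a - x) - (b - y) - l%:num); last by ring.
rewrite (_ : a - b - (x + - y - l%:num) = (a - x) - (b - y) + l%:num); last by ring.
rewrite (_ : a - b - (x - y) = (a - x) - (b - y)); last by ring.
set u := a - x; set v := b - y; have l0 : 0 < l%:num by [].
rewrite !ler_norml => /andP[u1 u2] /andP[v1 v2].
have [u0|/ltW u0] := leP 0 u; have [v0|/ltW v0] := leP 0 v.
- rewrite (ger0_norm u0) (ger0_norm v0); have [d|/ltW d] := leP 0 (u - v).
    by rewrite (ger0_norm d); lra.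
  by rewrite (ler0_norm d); lra.
- rewrite (ger0_norm u0) (ler0_norm v0) => h _ _; move: h.
  by rewrite ler0_norm; lra.
- rewrite (ler0_norm u0) (ger0_norm v0) => _ h _; move: h.
  by rewrite ger0_norm; lra.
- by rewrite (ler0_norm u0) (ler0_norm v0); have [d|/ltW d] := leP 0 (u - v);
    rewrite ?(ger0_norm d) ?(ler0_norm d); lra.
Qed.

End LatticeDistance.

(** * Flat tori *)

(* Points are represented in the fundamental domain of the lattice. *)
Record torus (R : realType) (n : nat) (l : 'I_n -> {posnum R}) := Torus {
  torus_rep :> 'rV[R]_n ;
  _ : [forall i, 0 <= torus_rep 0 i < (l i)%:num]
}.

HB.instance Definition _ R n l := [isSub for @torus_rep R n l].
HB.instance Definition _ R n l := [Choice of @torus R n l by <:].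

Section Torus.
Context {R : realType} {n : nat} {l : 'I_n -> {posnum R}}.
Implicit Types (x y : 'rV[R]_n) (p q : torus l).

Definition torus_reduce x : 'rV[R]_n :=
  \row_i (x 0 i - (l i)%:num * (Num.floor (x 0 i / (l i)%:num))%:~R).

Lemma torus_reduceP x :
  [forall i, 0 <= torus_reduce x 0 i < (l i)%:num].
Proof.
apply/forallP => i; rewrite mxE; have li : 0 < (l i)%:num by [].
have /andP[] := floor_itv (x 0 i / (l i)%:num).
rewrite intrD ler_pdivlMr// ltr_pdivrMr// => h1 h2; apply/andP; split; lra.
Qed.

Definition torus_proj x : torus l := Torus (torus_reduceP x).

Lemma torus_projP x : exists k : 'I_n -> int,
  forall i, torus_proj x 0 i = x 0 i + (l i)%:num * (k i)%:~R.
Proof.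
exists (fun i => - Num.floor (x 0 i / (l i)%:num)) => i.
by rewrite mxE intrN mulrN.
Qed.

Definition lattice_row x : 'rV[R]_n := \row_i lattice_dist (l i) (x 0 i).

Lemma lattice_row_period x y (k : 'I_n -> int) :
  (forall i, y 0 i = x 0 i + (l i)%:num * (k i)%:~R) -> lattice_row y = lattice_row x.
Proof. by move=> yx; apply/rowP => i; rewrite !mxE yx lattice_dist_period. Qed.

Definition torus_dist p q : R := enorm (lattice_row (torus_rep p - torus_rep q)).

Lemma torus_rep_inj p q :
  (forall i, lattice_dist (l i) (p 0 i - q 0 i) = 0) -> p = q.
Proof.
move=> h; apply/val_inj/rowP => i /=.
have [k kE _] := lattice_distP (l i) (p 0 i - q 0 i).
move: kE; rewrite h => /esym/eqP; rewrite normr_eq0 subr_eq0 => /eqP pq.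
have /forallP/(_ i)/andP[p0 p1] := valP p; have /forallP/(_ i)/andP[q0 q1] := valP q.
rewrite /= in p0 p1 q0 q1; have l0 : 0 < (l i)%:num by [].
have k1 : (k%:~R : R) < 1%:~R by rewrite -(ltr_pM2l l0) mulr1z mulr1; lra.
have k2 : (-1)%:~R < (k%:~R : R) by rewrite -(ltr_pM2l l0) mulrN1z mulrN1; lra.
move: k1 k2; rewrite !ltr_int => k1 k2.
have k0 : k = 0 by lia.
by move: pq; rewrite k0 mulr0 => /eqP; rewrite subr_eq0 => /eqP.
Qed.

Let torus_distxx p : torus_dist p p = 0.
Proof.
rewrite /torus_dist (_ : lattice_row _ = 0) ?enorm0//; apply/rowP => i.
rewrite !mxE subrr; apply/eqP.
by rewrite eq_le lattice_dist_ge0 (le_trans (lattice_dist_le_norm _ _)) ?normr0.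
Qed.

Let torus_dist_positivity p q : torus_dist p q = 0 -> p = q.
Proof.
move=> /enorm_eq0/rowP h; apply: torus_rep_inj => i; have := h i; by rewrite !mxE.
Qed.

Let torus_dist_sym p q : torus_dist p q = torus_dist q p.
Proof.
congr enorm; apply/rowP => i; rewrite !mxE -lattice_distN; congr lattice_dist; ring.
Qed.

Let torus_dist_triangle q p s : torus_dist p s <= torus_dist p q + torus_dist q s.
Proof.
rewrite (le_trans _ (ler_enormD _ _))// ler_enorm// => i; rewrite !mxE.
rewrite !ger0_norm ?addr_ge0 ?lattice_dist_ge0//.
rewrite (le_trans _ (lattice_distD _ _ _))// le_eqVlt; apply/orP; left; apply/eqP.
by congr lattice_dist; ring.
Qed.

HB.instance Definition _ := isMetric.Build R (torus l)
  torus_distxx torus_dist_positivity torus_dist_sym torus_dist_triangle.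
HB.instance Definition _ := isPointed.Build (torus l) (torus_proj 0).

Lemma torus_mdistE p q : mdist p q = torus_dist p q. Proof. by []. Qed.

Lemma torus_repK p : torus_proj p = p.
Proof.
apply: torus_rep_inj => i; have [k ->] := torus_projP p.
rewrite addrAC subrr lattice_dist_period; apply/eqP.
by rewrite eq_le lattice_dist_ge0 (le_trans (lattice_dist_le_norm _ _)) ?normr0.
Qed.

Lemma torus_mdist_proj x y :
  mdist (torus_proj x) (torus_proj y) = enorm (lattice_row (x - y)).
Proof.
have [k kP] := torus_projP x; have [j jP] := torus_projP y; congr enorm.
apply: (@lattice_row_period _ _ (fun i => k i - j i)) => i.
transitivity (torus_proj x 0 i - torus_proj y 0 i); first by rewrite !mxE.
by rewrite kP jP !mxE intrB; ring.
Qed.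

Lemma torus_mdist_proj_le x y : mdist (torus_proj x) (torus_proj y) <= enorm (x - y).
Proof.
rewrite torus_mdist_proj ler_enorm// => i.
by rewrite mxE (ger0_norm (lattice_dist_ge0 _ _)) lattice_dist_le_norm.
Qed.

Lemma torus_mdist_proj_small x y : (forall i, `|x 0 i - y 0 i| <= (l i)%:num / 2) ->
  mdist (torus_proj x) (torus_proj y) = enorm (x - y).
Proof.
move=> xy; rewrite torus_mdist_proj; apply/eqP; rewrite eq_le; apply/andP; split.
  by apply: ler_enorm => i; rewrite !mxE lattice_dist_small// normr_id.
by apply: ler_enorm => i; rewrite !mxE lattice_dist_small// normr_id.
Qed.

(** Choosing in each coordinate the representative of [q] nearest to [x] realises the torus distance
    as a Euclidean one. *)
Lemma torus_lift x q : exists y, [/\ torus_proj y = q,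
  forall i, `|x 0 i - y 0 i| <= (l i)%:num / 2 &
  enorm (x - y) = mdist (torus_proj x) q].
Proof.
have /choice[k kP] i : exists k : int,
    `|x 0 i - q 0 i - (l i)%:num * k%:~R| <= (l i)%:num / 2.
  by have [k _ kP] := lattice_distP (l i) (x 0 i - q 0 i); exists k.
pose y := \row_i (q 0 i + (l i)%:num * (k i)%:~R).
have yq : torus_proj y = q.
  rewrite -(torus_repK q); apply: torus_rep_inj => i.
  have [j ->] := torus_projP y; have [j' ->] := torus_projP q.
  rewrite mxE (_ : _ - _ = 0 + (l i)%:num * (k i + j i - j' i)%:~R).
    by rewrite lattice_dist_period lattice_dist_small normr0// divr_ge0.
  by rewrite intrB intrD; ring.
have xy i : `|x 0 i - y 0 i| <= (l i)%:num / 2 by rewrite mxE opprD addrA.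
by exists y; split => //; rewrite -yq torus_mdist_proj_small.
Qed.

Lemma torus_proj_continuous : continuous torus_proj.
Proof.
move=> x.
apply/(@metricType_numDomainType.cvgrPdist_lt _ _ _ (nbhs x) (nbhs_filter x)) => e e0.
have : \forall y \near x, enorm (x - y) < e.
  have n0 : 0 < n.+1%:R :> R by [].
  apply/nbhs_ballP; exists (e / n.+1%:R) => /=; first by rewrite divr_gt0.
  move=> y [_ xy]; rewrite (le_lt_trans (enorm_le_sum _))//.
  apply: (@le_lt_trans _ _ (\sum_(i < n) e / n.+1%:R)).
    by apply: ler_sum => i _; have := xy 0 i; rewrite /ball/= !mxE => /ltW.
  rewrite sumr_const card_ord -[ltLHS]mulr_natr mulrAC ltr_pdivrMr//.
  by rewrite ltr_pM2l// ltr_nat.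
by apply: filterS => y; apply: le_lt_trans; exact: torus_mdist_proj_le.
Qed.

(** The fundamental domain is half open, but the closed box also projects onto the torus. *)
Lemma torus_compact : compact [set: torus l].
Proof.
have -> : [set: torus l] =
    torus_proj @` [set x : 'rV[R]_n | forall i, `[0, (l i)%:num]%classic (x ord0 i)].
  apply/seteqP; split => // p _; exists p => /=; last exact: torus_repK.
  move=> i; rewrite in_itv/=; have /forallP/(_ i)/andP[-> /ltW ->] := valP p.
  by [].
apply: continuous_compact; last first.
  exact: (@rV_compact R n (fun i => `[0, (l i)%:num]%classic)
    (fun=> @segment_compact _ _ _)).
by apply: continuous_subspaceT; exact: torus_proj_continuous.
Qed.

Lemma torus_complete : complete_space (torus l).
Proof.
move=> u cu; exists (lim (u @ \oo)).
by apply: (compact_cauchy_cvg _ cu _ torus_compact); exact: filterT.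
Qed.

End Torus.

(** * Local geometry of flat tori *)

Section LengthSpaces.
Context {R : realType} {X : metricType R}.

Lemma mdist_le_path_length (g : R -> X) :
  ((mdist (g 0) (g 1))%:E <= path_length g 0 1)%E.
Proof.
apply: ereal_sup_ubound; exists [:: 1] => /=; first exact: itv_partition1.
by rewrite big_nat1.
Qed.

Lemma path_length_lipschitz (g : R -> X) (D : R) :
  (forall s t, mdist (g s) (g t) <= `|s - t| * D) -> (path_length g 0 1 <= D%:E)%E.
Proof.
move=> gD; apply: ge_ereal_sup => _ [s [ps /eqP ls] <-].
rewrite lee_fin; set t := nth 1 (0 :: s).
apply: (@le_trans _ _ (\sum_(0 <= k < size s) (t k.+1 - t k) * D)).
  rewrite big_nat_cond [leRHS]big_nat_cond ler_sum// => k /andP[/andP[_ ks] _].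
  rewrite (le_trans (gD _ _))// distrC gtr0_norm// subr_gt0.
  exact: (pathP 1 ps).
rewrite -mulr_suml telescope_sumr//.
have -> : t (size s) = 1 by rewrite /t -[size s]/(size (0 :: s)).-1 nth_last.
by rewrite /t/= subr0 mul1r.
Qed.

(** The one-step partition shows that no path is shorter than the distance; a path with Lipschitz
    constant [mdist x y] attains it. *)
Lemma length_space_geodesic :
  (forall x y : X, exists g : R -> X, [/\ g 0 = x, g 1 = y &
     forall s t, mdist (g s) (g t) <= `|s - t| * mdist x y]) -> length_space X.
Proof.
move=> H x y; apply/eqP; rewrite eq_le; apply/andP; split.
  apply: le_ereal_inf_tmp => _ [g [_ g0 g1] <-].
  by rewrite -g0 -g1 mdist_le_path_length.
have [g [g0 g1 gD]] := H x y.
apply: le_trans (path_length_lipschitz gD); apply: ereal_inf_lbound.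
exists g => //; split => //; apply: continuous_subspaceT => s.
apply/(@metricType_numDomainType.cvgrPdist_lt _ _ _ (nbhs s) (nbhs_filter s)) => e e0.
(* Adding 1 keeps the divisor positive when [x = y]. *)
have D0 : 0 < mdist x y + 1 by rewrite ltr_wpDl// mdist_ge0.
have : \forall t \near s, `|s - t| < e / (mdist x y + 1).
  by apply/nbhs_ballP; exists (e / (mdist x y + 1)) => //=; rewrite divr_gt0.
apply: filterS => t; rewrite ltr_pdivlMr// => st; rewrite (le_lt_trans (gD _ _))//.
by rewrite (le_lt_trans _ st)// ler_wpM2l// lerDl.
Qed.

End LengthSpaces.

Section FlatTorus.
Context {R : realType} {n : nat} {l : 'I_n -> {posnum R}}.
Local Notation T := (torus l).
Local Notation proj := (@torus_proj R n l).

Lemma torus_length_space : length_space T.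
Proof.
apply: length_space_geodesic => p q.
have [y [yq _ xy]] := torus_lift (torus_rep p) q; rewrite torus_repK in xy.
exists (fun s => proj (torus_rep p + s *: (y - torus_rep p))); split.
- by rewrite scale0r addr0 torus_repK.
- by rewrite scale1r addrC subrK.
- move=> s t; rewrite (le_trans (torus_mdist_proj_le _ _))//.
  by rewrite opprD addrACA subrr add0r -scalerBl enormZ -xy enormB.
Qed.

(** A quarter of a side: two points within this radius of a third differ by at most half a side in
    each coordinate, where [lattice_dist] is the absolute value. The initial value 1 covers the
    empty family. *)
Definition torus_radius : R := (\big[Num.min/1]_i (l i)%:num) / 4.

Lemma torus_radius_gt0 : 0 < torus_radius.
Proof. by rewrite divr_gt0//; elim/big_ind : _ => // a b a0 b0; rewrite lt_min a0. Qed.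

Lemma torus_radius_le i : torus_radius <= (l i)%:num / 4.
Proof. by rewrite ler_pM2r//; exact: bigmin_le_cond. Qed.

Lemma torus_proj_isometry (x y z : 'rV[R]_n) :
  enorm (x - y) <= torus_radius -> enorm (x - z) <= torus_radius ->
  mdist (proj y) (proj z) = enorm (y - z).
Proof.
move=> xy xz; apply: torus_mdist_proj_small => i.
have := coord_le_enorm (x - y) i; have := coord_le_enorm (x - z) i.
rewrite !mxE => h1 h2; have := ler_distD (x 0 i) (y 0 i) (z 0 i).
rewrite (distrC (y 0 i) (x 0 i)); have := torus_radius_le i; lra.
Qed.

(** [L a] is a lift of [a] nearest to [p], an inverse of the exponential map; by
    [torus_proj_isometry] it preserves distances on the ball of radius [torus_radius]. *)
Lemma torus_chart (p : T) : exists L : T -> 'rV[R]_n,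
  forall a, proj (L a) = a /\ enorm (torus_rep p - L a) = mdist p a.
Proof.
suff /choice[L LP] : forall a, exists x,
    proj x = a /\ enorm (torus_rep p - x) = mdist p a.
  by exists L.
move=> a; have [x [xa _ px]] := torus_lift (torus_rep p) a.
by exists x; split => //; rewrite px torus_repK.
Qed.

Lemma torus_curvature_ge0 : curvature_ge0 T.
Proof.
move=> x; exists (ball x torus_radius); first exact: nbhsx_ballx torus_radius_gt0.
have [L LP] := torus_chart x.
have Lm a b : ball x torus_radius a -> ball x torus_radius b ->
    mdist a b = enorm (L a - L b).
  rewrite ballEmdist/= => /ltW xa /ltW xb; rewrite -{1}(LP a).1 -{1}(LP b).1.
  by rewrite (@torus_proj_isometry (torus_rep x))// (LP _).2.
move=> p a b c Up Ua Ub Uc pabc; rewrite /comparison_angle !Lm//.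
apply: flat_perimeter; rewrite -[[:: L p; _; _; _]]/(map L [:: p; a; b; c]) map_inj_uniq//.
by move=> y z yz; rewrite -(LP y).1 -(LP z).1 yz.
Qed.

Section Directions.
Variables (p : T) (L : T -> 'rV[R]_n).
Hypothesis LP : forall a, proj (L a) = a /\ enorm (torus_rep p - L a) = mdist p a.
Implicit Types g h : geodesic p.

Definition torus_dir_at g s := s^-1 *: (L (g s) - torus_rep p).

Definition torus_scale g := Num.min (geo_len g) torus_radius.

Definition torus_dir g := torus_dir_at g (torus_scale g).

Let scale_gt0 g : 0 < torus_scale g.
Proof. by rewrite lt_min geo_len_gt0 torus_radius_gt0. Qed.

Let scaleI g : 0 < torus_scale g <= torus_scale g. Proof. by rewrite scale_gt0 lexx. Qed.

Let geoL g s : 0 < s <= torus_scale g ->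
  enorm (torus_rep p - L (g s)) = s /\ s <= torus_radius.
Proof.
move=> /andP[s0]; rewrite le_min => /andP[sl sr].
by rewrite (LP _).2 geo_dist0// sl ltW.
Qed.

Let distL g h s t : 0 < s <= torus_scale g -> 0 < t <= torus_scale h ->
  mdist (g s) (h t) = enorm (L (g s) - L (h t)).
Proof.
move=> /geoL[gs sr] /geoL[ht tr]; rewrite -{1}(LP (g s)).1 -{1}(LP (h t)).1.
by rewrite (@torus_proj_isometry (torus_rep p))// ?gs ?ht.
Qed.

Let dot_geo g h s t : 0 < s <= torus_scale g -> 0 < t <= torus_scale h ->
  mdist (g s) (h t) ^+ 2 =
  s ^+ 2 + t ^+ 2 - 2 * s * t * dot (torus_dir_at g s) (torus_dir_at h t).
Proof.
move=> sI tI; rewrite distL//.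
have [gs _] := geoL sI; have [ht _] := geoL tI.
case/andP: sI => s0 _; case/andP: tI => t0 _; rewrite /torus_dir_at.
move: (L (g s)) (L (h t)) gs ht => a b gs ht.
have -> : a - b = (a - torus_rep p) - (b - torus_rep p) by rewrite opprB addrA subrK.
move: gs ht; rewrite !(enormB (torus_rep p)).
move: (a - _) (b - _) => {}a {}b /(congr1 (fun z => z ^+ 2)) + /(congr1 (fun z => z ^+ 2)).
rewrite !sqr_enorm !dotE (dotC b a) => -> ->.
by field; rewrite !gt_eqF.
Qed.

(** The law of cosines compared with [mdist (g s) (g t) = |s - t|] forces the product to be 1, so
    lifted geodesics are straight near [p]. *)
Let dot_dir_at g s t : 0 < s <= torus_scale g -> 0 < t <= torus_scale g ->
  dot (torus_dir_at g s) (torus_dir_at g t) = 1.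
Proof.
move=> sI tI; have := dot_geo sI tI.
case/andP: sI => s0; case/andP: tI => t0; rewrite !le_min => /andP[tl _] /andP[sl _].
rewrite geo_dist ?sl ?tl ?ltW// real_normK ?num_real// => e.
have st : s * t != 0 by rewrite mulf_neq0// gt_eqF.
by apply: (mulfI st); lra.
Qed.

Let torus_dirE g s : 0 < s <= torus_scale g -> torus_dir_at g s = torus_dir g.
Proof. by move=> sI; apply: unit_dot1; exact: dot_dir_at. Qed.

Lemma range_torus_dir : range torus_dir = unit_orth [::].
Proof.
apply/seteqP; split => [_ [g _ <-]|u [u1 _]]; first by split => //; exact: dot_dir_at.
have eu : enorm u = 1 by rewrite /enorm u1 sqrtr1.
pose g s : T := proj (torus_rep p + s *: u).
have near_p s : 0 <= s <= torus_radius ->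
    enorm (torus_rep p - (torus_rep p + s *: u)) <= torus_radius.
  by move=> /andP[s0 s1]; rewrite opprD addrA subrr sub0r enormN enormZ eu mulr1 ger0_norm.
have g0 : g 0 = p by rewrite /g scale0r addr0 torus_repK.
have gd s t : 0 <= s <= torus_radius -> 0 <= t <= torus_radius ->
    mdist (g s) (g t) = `|s - t|.
  move=> sI tI; rewrite /g (torus_proj_isometry (near_p _ sI) (near_p _ tI)).
  by rewrite opprD addrACA subrr add0r -scalerBl enormZ eu mulr1.
pose gg := Geodesic torus_radius_gt0 g0 gd; exists gg => //.
have sc : torus_scale gg = torus_radius by rewrite /torus_scale/= minxx.
rewrite /torus_dir /torus_dir_at sc.
have rI : 0 <= torus_radius <= torus_radius by rewrite lexx ltW// torus_radius_gt0.
(* Both sides have the same projection and lie in the ball where [proj] is isometric. *)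
have Lg : L (gg torus_radius) = torus_rep p + torus_radius *: u.
  apply/eqP; rewrite -subr_eq0; apply/eqP/enorm_eq0.
  rewrite -(@torus_proj_isometry (torus_rep p)) ?near_p//.
    by rewrite (LP _).1 mdistxx.
  by have [|->] := @geoL gg torus_radius; rewrite ?sc ?lexx ?torus_radius_gt0.
by rewrite Lg addrC addKr scalerA mulVf ?scale1r// gt_eqF// torus_radius_gt0.
Qed.

(** By flatness the comparison cosine is constant for small [s], [t]. *)
Lemma angle_torus_dir g h : angle g h = acos (dot (torus_dir g) (torus_dir h)).
Proof.
have cI := unit_dot_bound (dot_dir_at (scaleI g) (scaleI g))
  (dot_dir_at (scaleI h) (scaleI h)).
apply: angle_cvg => // e e0; exists (Num.min (torus_scale g) (torus_scale h)).
  by rewrite lt_min !scale_gt0.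
move=> s t /andP[s0 +] /andP[t0 +].
rewrite lt_min => /andP[sg _]; rewrite lt_min => /andP[_ th].
have sI : 0 < s <= torus_scale g by rewrite s0 ltW.
have tI : 0 < t <= torus_scale h by rewrite t0 ltW.
rewrite dot_geo// !torus_dirE// (_ : _ / _ = dot (torus_dir g) (torus_dir h)).
  by rewrite subrr normr0.
by field; rewrite !gt_eqF.
Qed.

End Directions.

Lemma torus_boundary m : @alexandrov_boundary R m.+1 T = set0.
Proof.
apply/seteqP; split => // p [Y [dir [dirP [y Yy]]]].
have [L LP] := torus_chart p.
have [f fS] := space_of_directions_sphere
  (range_torus_dir LP) (angle_torus_dir LP) dirP.
have : @alexandrov_boundary R m Y y := Yy.
by rewrite (sphere_boundary m fS).
Qed.

End FlatTorus.

(** * Hausdorff measure *)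

Section Hausdorff.
Context {R : realType} {X : metricType R}.
Implicit Types (A : set X) (s d e : R).

Lemma diam_ge0 A : (0 <= diam A)%E.
Proof. by apply: ereal_sup_ubound; left. Qed.

Lemma mdist_le_diam A x y : A x -> A y -> ((mdist x y)%:E <= diam A)%E.
Proof. by move=> Ax Ay; apply: ereal_sup_ubound; right; exists (x, y). Qed.

Lemma diam_le A d : 0 <= d -> (forall x y, A x -> A y -> mdist x y <= d) ->
  (diam A <= d%:E)%E.
Proof.
move=> d0 Ad; apply: ge_ereal_sup => _ [->|[[x y] [Ax Ay] <-]]; rewrite lee_fin//.
exact: Ad.
Qed.

Lemma diam_set0 : diam (@set0 X) = 0%E.
Proof. by apply/eqP; rewrite eq_le diam_ge0 diam_le. Qed.

Lemma hausdorff_premeasure_ge0 s d : (0 <= hausdorff_premeasure X s d)%E.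
Proof.
apply: le_ereal_inf_tmp => _ [U _ <-]; apply: nneseries_ge0 => k _ _.
exact: poweR_ge0.
Qed.

Lemma hausdorff_measure_ge0 s : (0 <= hausdorff_measure X s)%E.
Proof.
apply: le_trans (hausdorff_premeasure_ge0 s 1) _; apply: ereal_sup_ubound.
by exists 1 => //=; exact: ltr01.
Qed.

Lemma hausdorff_premeasure_finite_cover s d (I : finType) (U : I -> set X) :
  0 < s -> 0 <= d -> \bigcup_i U i = [set: X] ->
  (forall i x y, U i x -> U i y -> mdist x y <= d) ->
  (hausdorff_premeasure X s d <= (#|I|%:R * d `^ s)%:E)%E.
Proof.
move=> s0 d0 UT Ud.
(* The finite cover is continued by empty sets, which contribute 0 to the sum because [s > 0]. *)
pose V k := [set x | exists2 i, enum_rank i = k :> nat & U i x].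
have Vd k : (diam (V k) <= d%:E)%E.
  apply: diam_le => // x y [i ik Ux] [j jk Uy].
  have ij : i = j by apply/enum_rank_inj/val_inj; rewrite /= ik jk.
  by apply: (Ud i) => //; rewrite ij.
have V0 k : (#|I| <= k)%N -> diam (V k) = 0%E.
  move=> Ik; rewrite (_ : V k = set0) ?diam_set0//; apply/seteqP; split => // x [i ik _].
  by move: (ltn_ord (enum_rank i)); rewrite ik ltnNge Ik.
apply: (@le_trans _ _ (\sum_(0 <= k <oo) diam (V k) `^ s)%E).
  apply: ereal_inf_lbound; exists V => //; split => //.
  apply/seteqP; split => // x _.
  have [i _ Ux] : (\bigcup_i U i) x by rewrite UT.
  by exists (enum_rank i : nat) => //; exists i.
apply: lime_le; first by apply: is_cvg_nneseries => k _ _; exact: poweR_ge0.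
near=> m.
suff h : (\sum_(0 <= k < m) diam (V k) `^ s <= ((minn m #|I|)%:R * d `^ s)%:E)%E.
  by rewrite (le_trans h)// lee_fin ler_wpM2r ?powR_ge0// ler_nat geq_minr.
elim: (m) => [|j IH]; first by rewrite big_nil min0n mul0r.
rewrite big_nat_recr//=; have [Ij|jI] := leqP #|I| j.
  rewrite V0// poweR0r ?gt_eqF// adde0 (le_trans IH)//.
  by rewrite lee_fin ler_wpM2r ?powR_ge0// ler_nat leq_min geq_minr geq_min leqnSn.
rewrite (minn_idPl jI); move: IH; rewrite (minn_idPl (ltnW jI)) => IH.
rewrite -addn1 natrD mulrDl mul1r EFinD leeD// -poweR_EFin.
by apply: gt0_ler_poweR; rewrite ?(ltW s0) ?in_itv/= ?leey ?andbT ?diam_ge0 ?lee_fin.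
Unshelve. all: by end_near. Qed.

Lemma hausdorff_measure_eq0 s : 0 < s ->
  (forall e, 0 < e -> exists d (I : finType) (U : I -> set X),
    [/\ 0 <= d <= e, \bigcup_i U i = [set: X],
      forall i x y, U i x -> U i y -> mdist x y <= d & #|I|%:R * d `^ s <= e]) ->
  hausdorff_measure X s = 0%E.
Proof.
move=> s0 H; apply/eqP; rewrite eq_le hausdorff_measure_ge0 andbT.
apply: ge_ereal_sup => _ [d /= d0 <-]; apply/lee_addgt0Pr => e e0; rewrite add0e.
(* The minimum makes the cover admissible at scale [d] and its sum at most [e]. *)
have [|c [I [U [/andP[c0 ce] UT Uc Ie]]]] := H (Num.min d e); first by rewrite lt_min d0.
move: ce Ie; rewrite !le_min => /andP[cd _] /andP[_ Ie].
apply: (@le_trans _ _ (#|I|%:R * c `^ s)%:E); last by rewrite lee_fin.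
apply: le_trans (hausdorff_premeasure_finite_cover s0 c0 UT Uc).
apply: le_ereal_inf => _ [V [VT Vc] <-]; exists V => //; split => // k.
by rewrite (le_trans (Vc k))// lee_fin.
Qed.

(* Enlarging the pieces makes the cover open, hence reducible to a finite one,
   and makes all its diameters positive. *)
Lemma hausdorff_measure0_finite_cover s e : cover_compact [set: X] ->
  0 < s -> hausdorff_measure X s = 0%E -> 0 < e ->
  exists (K : nat) (V : nat -> set X) (D : nat -> R),
    [/\ forall k, 0 < D k, forall x, exists2 k, (k < K)%N & V k x,
       forall k x y, V k x -> V k y -> mdist x y <= D k
     & \sum_(k < K) D k `^ s <= e].
Proof.
move=> cX s0 H0 e0.
have e2 : 0 < e / 2 by rewrite divr_gt0.
have : (hausdorff_premeasure X s 1 < (e / 2)%:E)%E.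
  apply: (@le_lt_trans _ _ 0%E); last by rewrite lte_fin.
  by rewrite -H0; apply: ereal_sup_ubound; exists 1 => //=; exact: ltr01.
move=> /ereal_inf_lt[_ [U [UT U1] <-] sU].
pose r k := fine (diam (U k)).
have rE k : diam (U k) = (r k)%:E.
  rewrite fineK// ge0_fin_numE ?diam_ge0// (le_lt_trans (U1 k))// ltry//.
have r0 k : 0 <= r k by rewrite -lee_fin -rE diam_ge0.
(* Half of [e] pays for the original cover; the other half is spread geometrically over the
   enlargements. *)
pose w k := e / 2 * 2^-1 ^+ k.+1.
have w0 k : 0 < w k by rewrite mulr_gt0// exprn_gt0// invr_gt0.
pose D k := (r k `^ s + w k) `^ s^-1.
have Ds k : D k `^ s = r k `^ s + w k.
  by rewrite -powRrM mulVf ?gt_eqF// powRr1// addr_ge0 ?powR_ge0 ?ltW.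
have rD k : r k < D k.
  rewrite ltNge; apply/negP => Dr.
  have : D k `^ s <= r k `^ s by rewrite ge0_ler_powR ?nnegrE ?powR_ge0// ltW.
  by rewrite Ds leNgt ltrDl w0.
(* Thickening by half the gap on either side raises the diameter from [r k] to at most [D k]. *)
pose V k := \bigcup_(y in U k) (ball y ((D k - r k) / 2))°.
have [F _ FV] : finite_subset_cover [set: nat] V [set: X].
  apply: cX => [k _|x _]; first by apply: bigcup_open => y _; exact: open_interior.
  have [k _ Ux] : (\bigcup_k U k) x by rewrite UT.
  exists k => //; exists x => //; apply: nbhsx_ballx.
  by rewrite divr_gt0// subr_gt0.
exists (\max_(k <- finmap.enum_fset F) k).+1, V, D; split.
- by move=> k; exact: le_lt_trans (rD k).
- move=> x; have [k kF Vx] := FV x I; exists k => //.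
  by rewrite ltnS (leq_bigmax_seq (F := id)).
- move=> k x y [a Ua /interior_subset] + [b Ub /interior_subset].
  rewrite !ballEmdist/= => xa yb.
  have ab : mdist a b <= r k by rewrite -lee_fin -rE mdist_le_diam.
  have := metric_triangle x a y; have := metric_triangle a b y.
  by rewrite (metric_sym x a); lra.
- set K := _.+1; under eq_bigr do rewrite Ds.
  rewrite big_split/= (splitr e) lerD//.
    rewrite -lee_fin -sumEFin; apply/ltW/le_lt_trans; last exact: sU.
    rewrite -(big_mkord xpredT (fun k => (r k `^ s)%:E)).
    under eq_bigr do rewrite -poweR_EFin -rE.
    by apply: nneseries_lim_ge => k _ _; exact: poweR_ge0.
  rewrite -mulr_sumr ler_piMr ?(ltW e2)//.
  have -> : \sum_(k < K) 2^-1 ^+ k.+1 = 1 - 2^-1 ^+ K :> R.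
    elim: K => [|K IH]; first by rewrite big_ord0 expr0 subrr.
    by rewrite big_ord_recr/= IH !exprS; lra.
  by rewrite lerBlDr lerDl exprn_ge0.
Qed.

End Hausdorff.

(** * Hausdorff dimension of flat tori *)

(** Subtracting in each coordinate the minimum over [A] injects [A] into a cube with [m.+1] points
    per side. *)
Lemma card_ffun_bounded_diameter n N m (A : {set {ffun 'I_n -> 'I_N}}) :
  (forall (f g : {ffun 'I_n -> 'I_N}) (i : 'I_n),
     f \in A -> g \in A -> (f i <= g i + m)%N) ->
  (#|A| <= m.+1 ^ n)%N.
Proof.
move=> Am; have [->|[f0 f0A]] := set_0Vmem A; first by rewrite cards0.
pose a (i : 'I_n) := [arg min_(f < f0 in A) (f i : nat)].
have aA i : a i \in A by rewrite /a; case: arg_minnP.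
have aP i f : f \in A -> (a i i <= f i)%N by rewrite /a; case: arg_minnP => // h _ + fA; apply.
pose phi (f : {ffun 'I_n -> 'I_N}) := [ffun i => inord (f i - a i i) : 'I_m.+1].
have phi_inj : {in A &, injective phi}.
  move=> f g fA gA /ffunP fg; apply/ffunP => i; apply/val_inj.
  have := aP i f fA; have := aP i g gA.
  have := Am g (a i) i gA (aA i); have := Am f (a i) i fA (aA i).
  move=> h1 h2 h3 h4; have := congr1 val (fg i); rewrite !ffunE /= !inordK ?ltnS ?leq_subLR//.
  by move/eqP; rewrite eqn_sub2rE// => /eqP.
by rewrite -(card_in_imset phi_inj) (leq_trans (max_card _))// card_ffun !card_ord.
Qed.

Section TorusDimension.
Context {R : realType} {n : nat} {l : 'I_n -> {posnum R}}.
Local Notation T := (torus l).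
Local Notation proj := (@torus_proj R n l).
Local Notation radius := (@torus_radius R n l).

(* Counting, in each piece of the cover, the points of a grid of mesh
   [radius / N] with [N] large. *)
Lemma torus_finite_cover_volume K (V : nat -> set T) (D : nat -> R) :
  (forall k, 0 < D k) -> (forall x, exists2 k, (k < K)%N & V k x) ->
  (forall k x y, V k x -> V k y -> mdist x y <= D k) ->
  (radius / 2) ^+ n <= \sum_(k < K) D k ^+ n.
Proof.
move=> D0 VT VD; move: (torus_radius_gt0 (l := l)) (torus_radius_le (l := l)).
move: (torus_radius (l := l)) => rho rad0 rad_le.
(* [N] exceeds every [rho / D k], so [D k * N / rho >= 1]; this absorbs the extra 1 in the count of
   grid points per side, at the price of a factor 2. *)
pose N := (Num.trunc (\sum_(k < K) rho / D k)).+1.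
have N0 : 0 < N%:R :> R by rewrite ltr0n.
have ND (k : 'I_K) : rho <= D k * N%:R.
  rewrite mulrC -ler_pdivrMr// ltW// (le_lt_trans _ (truncnS_gt _))//.
  rewrite (bigD1 k)//= lerDl sumr_ge0// => j _.
  by rewrite divr_ge0// ltW.
(* The grid has coordinates in [0, rho), and [rho <= l i / 4], so distances between its points
   survive projection to the torus. *)
pose x (f : {ffun 'I_n -> 'I_N}) : 'rV[R]_n := \row_i (rho * (f i)%:R / N%:R).
have x_dist (f g : {ffun 'I_n -> 'I_N}) (i : 'I_n) :
    rho * `|(f i)%:R - (g i)%:R| / N%:R <= mdist (proj (x f)) (proj (x g)).
  have xfg j : `|x f 0 j - x g 0 j| = rho * `|(f j)%:R - (g j)%:R| / N%:R.
    have -> : x f 0 j - x g 0 j = rho * ((f j)%:R - (g j)%:R) / N%:R.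
      by rewrite !mxE mulrBr mulrBl.
    by rewrite !normrM (gtr0_norm rad0) (@gtr0_norm _ N%:R^-1)// invr_gt0.
  rewrite torus_mdist_proj_small => [|j].
    rewrite -xfg (_ : x f 0 i - x g 0 i = (x f - x g) 0 i) ?coord_le_enorm//.
    by rewrite !mxE.
  rewrite xfg; apply: (@le_trans _ _ rho).
    rewrite -mulrA ler_piMr ?(ltW rad0)// ler_pdivrMr// mul1r ler_norml.
    have := ltn_ord (f j); have := ltn_ord (g j).
    rewrite -!(ltr_nat R) => h1 h2; have := ler0n R (f j); have := ler0n R (g j).
    by move=> *; apply/andP; split; lra.
  by have := rad_le j; have : 0 < (l j)%:num by []; lra.
pose A k := [set f | `[< V k (proj (x f)) >]]%SET.
have cardA (k : 'I_K) : (#|A k|%:R : R) <= (2 * N%:R / rho) ^+ n * D k ^+ n.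
  pose m := Num.trunc (D k * N%:R / rho).
  have y0 : 0 <= D k * N%:R / rho by rewrite divr_ge0 ?mulr_ge0// ltW.
  apply: (@le_trans _ _ ((m.+1 ^ n)%:R)).
    rewrite ler_nat; apply: card_ffun_bounded_diameter => f g i.
    rewrite !inE => /asboolP/asboolP Vf /asboolP/asboolP Vg; rewrite -leq_subLR.
    rewrite truncn_ge_nat// ler_pdivlMr//.
    have [fg|/ltnW gf] := leqP (f i) (g i).
      by rewrite (eqP (fg : (_ - _ == 0)%N)) mul0r mulr_ge0// ltW.
    have := le_trans (x_dist f g i) (VD k _ _ Vf Vg).
    by rewrite ler_pdivrMr// natrB// ger0_norm ?subr_ge0 ?ler_nat// mulrC.
  have /andP[h _] := truncn_itv y0; rewrite -/m in h.
  have y1 : 1 <= D k * N%:R / rho by rewrite ler_pdivlMr// mul1r.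
  have e : 2 * N%:R / rho * D k = 2 * (D k * N%:R / rho) by field; rewrite gt_eqF.
  rewrite natrX -exprMn e lerXn2r ?nnegrE ?ler0n//; first by rewrite mulr_ge0.
  by rewrite -addn1 natrD; lra.
have NA : (N%:R : R) ^+ n <= \sum_(k < K) #|A k|%:R.
  (* Double counting of the pairs of a grid point and a piece containing it. *)
  rewrite -natrX -natr_sum ler_nat.
  rewrite -[in leqLHS](card_ord N) -[in leqLHS](card_ord n) -card_ffun -sum1_card.
  have -> : (\sum_(k < K) #|A k| = \sum_f \sum_(k < K) (f \in A k))%N.
    rewrite exchange_big/=; apply: eq_bigr => k _; rewrite -sum1_card big_mkcond.
    by apply: eq_bigr => f _; case: (f \in A k).
  apply: leq_sum => f _; have [k kK Vk] := VT (proj (x f)).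
  rewrite (bigD1 (Ordinal kK))//= (_ : f \in A k) ?leq_addr//.
  by rewrite inE; apply/asboolP.
have := le_trans NA (ler_sum _ (fun k _ => cardA k)).
rewrite -mulr_sumr => h.
have c0 : 0 < (2 * N%:R / rho) ^+ n by rewrite exprn_gt0// divr_gt0// mulr_gt0.
rewrite -(ler_pM2l c0) (le_trans _ h)// -exprMn.
by rewrite (_ : 2 * N%:R / rho * (rho / 2) = N%:R)//; field; rewrite gt_eqF.
Qed.

Lemma torus_hausdorff_measure_neq0 s : 0 < s -> s <= n%:R -> hausdorff_measure T s <> 0%E.
Proof.
move=> s0 sn H0; pose c := (radius / 2) ^+ n.
have c0 : 0 < c by rewrite exprn_gt0// divr_gt0// torus_radius_gt0.
pose e := Num.min c 1 / 2.
have e0 : 0 < e by rewrite divr_gt0// lt_min c0 ltr01.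
have ec : e < c by rewrite ltr_pdivrMr// gt_min; apply/orP; left; lra.
have e1 : e <= 1 by rewrite ler_pdivrMr// ge_min; apply/orP; right; lra.
have cT : cover_compact [set: T] by rewrite -compact_cover; exact: torus_compact.
have [K [V [D [D0 VT VD sD]]]] := hausdorff_measure0_finite_cover cT s0 H0 e0.
have := torus_finite_cover_volume D0 VT VD; rewrite -/c leNgt => /negP; apply.
have sD1 := le_trans sD e1.
apply: (le_lt_trans _ ec); apply: (le_trans _ sD); apply: ler_sum => k _.
have Ds1 : D k `^ s <= 1.
  have := sD1.
  by rewrite (bigD1 k)//=; apply: le_trans; rewrite lerDl sumr_ge0// => j _; exact: powR_ge0.
have D1 : D k <= 1.
  have one : 1 = 1 `^ s^-1 :> R by rewrite powR1.
  have -> : D k = (D k `^ s) `^ s^-1 by rewrite -powRrM mulfV ?gt_eqF// powRr1// ltW.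
  rewrite [leRHS]one.
  by rewrite ge0_ler_powR ?nnegrE ?powR_ge0 ?invr_ge0 ?(ltW s0).
by rewrite -powR_mulrn ?(ltW (D0 k))//; apply: ger_powR => //; rewrite D0.
Qed.

Lemma torus_hausdorff_measure_eq0 s : n%:R < s -> hausdorff_measure T s = 0%E.
Proof.
move=> ns; have s0 : 0 < s by exact: le_lt_trans ns.
apply: hausdorff_measure_eq0 => // e e0.
(* [M / N] bounds the diameter of a grid cell; the 1 keeps [M] positive when there are no sides. *)
pose M : R := 1 + \sum_i (l i)%:num.
have M0 : 0 < M by rewrite ltr_pwDl// sumr_ge0.
have sn0 : 0 < s - n%:R by rewrite subr_gt0.
(* For [N > B], the first summand gives [N ^ n * (M / N) ^ s <= e], the second [M / N <= e]. *)
pose B := (M `^ s / e) `^ (s - n%:R)^-1 + M / e.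
have B0 : 0 <= B by rewrite addr_ge0 ?powR_ge0 ?divr_ge0// ltW.
pose N := (Num.trunc B).+1; have BN : B < N%:R by exact: truncnS_gt.
have N0 : 0 < N%:R :> R by rewrite ltr0n.
exists (M / N%:R), {ffun 'I_n -> 'I_N}.
exists (fun f : {ffun 'I_n -> 'I_N} => [set p : T | forall i : 'I_n,
  (l i)%:num * (f i)%:R / N%:R <= p 0 i <= (l i)%:num * (f i).+1%:R / N%:R]).
split.
- rewrite divr_ge0 ?(ltW M0) ?(ltW N0)//= ler_pdivrMr// mulrC -ler_pdivrMr//.
  by rewrite (le_trans _ (ltW BN))// lerDr powR_ge0.
- apply/seteqP; split => // p _.
  have /choice[f fP] : forall i, exists j : 'I_N,
      (l i)%:num * j%:R / N%:R <= p 0 i <= (l i)%:num * j.+1%:R / N%:R.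
    move=> i; have /forallP/(_ i)/andP[p0 pl] := valP p; have l0 : 0 < (l i)%:num by [].
    rewrite /= in p0 pl.
    have z0 : 0 <= p 0 i * N%:R / (l i)%:num by rewrite divr_ge0// mulr_ge0// ltW.
    have zN : (Num.trunc (p 0 i * N%:R / (l i)%:num)%R < N)%N.
      by rewrite truncn_lt_nat// ltr_pdivrMr// mulrC ltr_pM2l.
    exists (Ordinal zN) => /=; have /andP[h1 h2] := truncn_itv z0.
    move: h1 (ltW h2); rewrite ler_pdivlMr// ler_pdivrMr// => h1 {}h2.
    by rewrite ler_pdivrMr// ler_pdivlMr// ![(l i)%:num * _]mulrC h1 h2.
  by exists [ffun i => f i] => // i; rewrite ffunE.
- move=> f p q fp fq; rewrite -(torus_repK p) -(torus_repK q).
  rewrite (le_trans (torus_mdist_proj_le _ _))// (le_trans (enorm_le_sum _))//.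
  apply: (@le_trans _ _ (\sum_i (l i)%:num / N%:R)).
    apply: ler_sum => i _; have /andP[p0 p1] := fp i; have /andP[q0 q1] := fq i.
    move: p1 q1; rewrite -[(f i).+1]addn1 natrD mulrDr mulrDl mulr1 => p1 q1.
    by rewrite !mxE ler_norml; apply/andP; split; lra.
  by rewrite -mulr_suml ler_pM2r ?invr_gt0// lerDr.
- rewrite card_ffun !card_ord natrX powRM ?invr_ge0 ?(ltW M0) ?(ltW N0)//.
  rewrite -(powR_inv1 (ltW N0)) -powRrM mulN1r powRN mulrCA -powR_mulrn ?(ltW N0)//.
  rewrite -powRN -powRD ?(gt_eqF N0) ?implybT//.
  rewrite -[n%:R - s]opprB powRN ler_pdivrMr ?powR_gt0// mulrC -ler_pdivrMr//.
  have -> : M `^ s / e = ((M `^ s / e) `^ (s - n%:R)^-1) `^ (s - n%:R).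
    by rewrite -powRrM mulVf ?gt_eqF// powRr1// divr_ge0 ?powR_ge0 ?(ltW e0).
  rewrite ge0_ler_powR ?nnegrE ?powR_ge0 ?(ltW sn0) ?(ltW N0)//.
  by rewrite (le_trans _ (ltW BN))// lerDl divr_ge0// ltW.
Qed.

Lemma torus_hausdorff_dim : hausdorff_dim T = n%:R%:E.
Proof.
apply/eqP; rewrite eq_le; apply/andP; split.
  apply/lee_addgt0Pr => e e0; apply: ereal_inf_lbound; exists (n%:R + e) => //.
  have ne : n%:R < n%:R + e by rewrite ltrDl.
  by split; [exact: le_lt_trans ne|exact: torus_hausdorff_measure_eq0].
apply: le_ereal_inf_tmp => _ [s [s0 H0] <-]; rewrite lee_fin leNgt; apply/negP => /ltW sn.
exact: torus_hausdorff_measure_neq0 H0.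
Qed.

End TorusDimension.

(** * Thin tori *)

Lemma torus_alexandrov (R : realType) n (l : 'I_n.+1 -> {posnum R}) :
  alexandrov_ge0 n.+1 (torus l) /\ closed_alexandrov n.+1 (torus l).
Proof.
split; split; [exact: torus_complete|exact: torus_length_space|exact: torus_curvature_ge0
  |exact: torus_hausdorff_dim|exact: torus_complete|exact: torus_boundary].
Qed.

(** A complete space is its own completion. Taking every [t j] equal to [r], the set in [tetra_h]
    lies in the sphere of radius [r] about [p], so [tetra_h] is either the default 0 or an infimum
    of distances below [C * r]. *)
Lemma not_tetrahedral_small_sphere (R : realType) (X : metricType R) n
    (C beta r : R) (p : X) :
  complete_space X -> 0 < C -> 0 < beta -> 0 < r ->
  (forall x y, mdist x p = r -> mdist y p = r -> mdist x y < C * r) ->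
  ~ tetrahedral n C beta r X.
Proof.
move=> cX C0 b0 r0 H tX.
have iX : is_completion (id : X -> X).
  by split => // O [x Ox] _; exists x; split => //; exists x.
have [q [_ /(_ (fun=> r))]] := tX X id iX p.
have rI : (1 - beta) * r <= r <= (1 + beta) * r by apply/andP; split; nra.
have Cr : 0 < C * r by rewrite mulr_gt0.
move=> /(_ (fun=> rI)); apply/negP; rewrite -ltNge /tetra_h.
case: asboolP => // -[x [y [Sx Sy xy]]].
rewrite (le_lt_trans _ (H x y Sx.1 Sy.1))//; apply: ge_inf; last by exists (x, y).
by exists 0 => _ [z _ <-]; exact: mdist_ge0.
Qed.

Section ThinTorus.
Context {R : realType} {n : nat} {r e : R} (r0 : 0 < r) (e0 : 0 < e).

(** Antipodes on the long circle are [r + e / 2] apart: just beyond [r], so the diameter exceeds [r]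
    while the points at distance [r] remain close to the antipode. *)
Definition thin_side (i : 'I_n.+1) : R := if i == ord0 then 2 * r + e else e.

Lemma thin_side_gt0 i : 0 < thin_side i.
Proof. by rewrite /thin_side; case: ifP => // _; rewrite addr_gt0// mulr_gt0. Qed.

Definition thin_torus : metricType R := torus (fun i => PosNum (thin_side_gt0 i)).

Lemma thin_torus_diam : (r%:E < diam [set: thin_torus])%E.
Proof.
pose l i := PosNum (thin_side_gt0 i).
pose x : 'rV[R]_n.+1 := delta_mx 0 0; pose y := (r + e / 2) *: x.
apply: (@lt_le_trans _ _
  (mdist (torus_proj (l := l) 0) (torus_proj (l := l) y))%:E); last first.
  exact: mdist_le_diam.
have y0 : 0 <= r + e / 2 by rewrite addr_ge0 ?divr_ge0 ?ltW.
rewrite lte_fin torus_mdist_proj_small => [|i].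
  by rewrite enormB subr0 enormZ enorm_delta mulr1 ger0_norm// ltrDl divr_gt0.
rewrite !mxE sub0r normrN eqxx/= /thin_side; have [_|_] := eqVneq i ord0.
  by rewrite mulr1 ger0_norm//; lra.
by rewrite mulr0 normr0 divr_ge0// ltW.
Qed.

(** The short circles contribute at most [n * e / 2] to any distance, so [x] and [y] are at least
    [r - n * e / 2] from [p] along the long one. Its perimeter [2 * r + e] leaves at most
    [e + n * e] between them there, and the short circles add [n * e / 2] again. *)
Lemma thin_torus_sphere (p x y : thin_torus) :
  mdist x p = r -> mdist y p = r -> mdist x y <= 2 * n.+1%:R * e.
Proof.
pose l i := PosNum (thin_side_gt0 i).
have dE (a b : torus l) :
    mdist a b <= lattice_dist (l ord0) (a 0 ord0 - b 0 ord0) + n%:R * (e / 2).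
  rewrite torus_mdistE (le_trans (enorm_le_sum _))// big_ord_recl lerD//.
    by rewrite !mxE ger0_norm ?lattice_dist_ge0.
  rewrite mulr_natl -[leRHS](_ : \sum_(i < n) e / 2 = _); last by rewrite sumr_const card_ord.
  apply: ler_sum => i _; rewrite mxE ger0_norm ?lattice_dist_ge0//.
  exact: lattice_dist_le_half.
move=> xp yp; have := dE x p; have := dE y p; have := dE x y; rewrite xp yp.
have := lattice_dist_perimeter (l ord0) (x 0 ord0 - p 0 ord0) (y 0 ord0 - p 0 ord0).
rewrite (_ : x 0 ord0 - p 0 ord0 - (y 0 ord0 - p 0 ord0) =
  x 0 ord0 - y 0 ord0); last by ring.
rewrite [X in _ <= X -> _](_ : _ = 2 * r + e)//.
have ne : 0 <= n%:R * e by rewrite mulr_ge0// ltW.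
by rewrite -(natr1 n); have := ltW e0; lra.
Qed.

End ThinTorus.

Theorem corollary3p4 (R : realType) (n : nat) (r : R)
    (n_gt0 : (0 < n)%N) (r_gt0 : 0 < r) :
  [/\ forall C beta : R, 0 < C -> 0 < beta < 1 ->
        exists X : metricType R,
          alexandrov_ge0 n X /\ ~ tetrahedral n C beta r X,
      forall C beta : R, 0 < C -> 0 < beta < 1 ->
        exists X : metricType R,
          [/\ alexandrov_ge0 n X, (r%:E < diam [set: X])%E
            & ~ tetrahedral n C beta r X]
    & forall C beta : R, 0 < C -> 0 < beta < 1 ->
        exists X : metricType R,
          [/\ alexandrov_ge0 n X, closed_alexandrov n X
            & ~ tetrahedral n C beta r X]].
Proof.
suff H C beta : 0 < C -> 0 < beta < 1 -> exists X : metricType R,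
    [/\ alexandrov_ge0 n X, closed_alexandrov n X, (r%:E < diam [set: X])%E
      & ~ tetrahedral n C beta r X].
  by split=> C beta C0 bI; have [X [? ? ? ?]] := H C beta C0 bI; exists X.
case: n n_gt0 => // m _ C0 /andP[b0 _].
(* With this [e] the bound [2 * m.+1 * e] of [thin_torus_sphere] equals [C * r / 2]. *)
have e0 : 0 < C * r / (4 * m.+1%:R) by rewrite divr_gt0// mulr_gt0.
exists (thin_torus (n := m) r_gt0 e0).
have [aT cT] := torus_alexandrov (fun i : 'I_m.+1 => PosNum (thin_side_gt0 r_gt0 e0 i)).
split=> //; first exact: thin_torus_diam.
apply: (not_tetrahedral_small_sphere (p := torus_proj 0)) => //; first exact: torus_complete.
move=> x y xp yp; rewrite (le_lt_trans (thin_torus_sphere xp yp))//.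
have : 0 < m.+1%:R :> R by rewrite ltr0n.
move: m.+1%:R => k k0; rewrite (_ : 2 * k * _ = C * r / 2); last by field; rewrite gt_eqF.
by rewrite ltr_pdivrMr// ltr_pMr ?mulr_gt0// ltr1n.
Qed.
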